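(* Let $q$ be generic and let $R(\lambda)$ be a $U_q(sl_2)$-invariant solution of the Yang–Baxter equation on $V_s^{\otimes3}$ for a spin $s\ge2$ satisfying $r_{2s}(\lambda)=1$ and $r_j(0)=1$, $r_j(\lambda)r_j(-\lambda)=1$ for all $j$. If $$r_{2s-1}(\lambda)=\frac{[2s+\lambda]_q}{[2s-\lambda]_q},$$ then $$r_{2s-2}(\lambda)=\frac{[2s+\lambda]_q}{[2s-\lambda]_q}\,\frac{[2s-1+\lambda]_q}{[2s-1-\lambda]_q}.$$ As a consequence, for $s\ge2$, there exist no $U_q(sl_2)$-invariant regular R-matrices whose $q\to1$ limit coincides with either of the $sl_2$-invariant R-matrices $$R(\lambda)=(1-\lambda)^{-1}\bigl(\mathbb E-\lambda\,\mathbb P\bigr)$$ or $$R(\lambda)=(1-\lambda)^{-1}\Bigl(\mathbb E-\lambda\,\mathbb P+\frac{\beta\lambda}{\lambda-\alpha}P^0\Bigr),\qquad \alpha=s+\tfrac12+(-1)^{2s+1},\quad \beta=(2s+1)(-1)^{2s+1}.$$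
   Context: Fix $q\in\mathbb C$ and a value of $\log q$; put $q^t=e^{t\log q}$, $[t]_q=(q^t-q^{-t})/(q-q^{-1})$ ($[t]_1=t$). ''Generic'' means $q\neq 0,\infty$ and $q$ is not a root of unity. $U_q(sl_2)$ is the unital associative $\mathbb C$-algebra with generators $S^\pm,S^z$, relations $[S^+,S^-]=[2S^z]_q$, $[S^z,S^\pm]=\pm S^\pm$, and co-multiplication $\Delta(S^\pm)=S^\pm\otimes q^{-S^z}+q^{S^z}\otimes S^\pm$, $\Delta(S^z)=S^z\otimes e+e\otimes S^z$ ($q=1$ being the undeformed $sl_2$). $V_s$ is its irreducible highest weight representation of spin $s\in\frac12\mathbb Z_{\ge0}$, of dimension $2s+1$, with basis $|k\rangle$, $k=-s,\dots,s$, $S^z|k\rangle=k|k\rangle$. Under $\Delta$, $V_s^{\otimes 2}=\bigoplus_{j=0}^{2s}V_j$; $P^j$ is the projector onto the component $V_j$ along the other components; $\mathbb E$ is the identity operator. At $q=1$, $\mathbb P=\sum_{j=0}^{2s}(-1)^{2s-j}P^j$ is the permutation in $V_s\otimes V_s$. A $U_q(sl_2)$-invariant $R(\lambda)\in\mathrm{End}\,V_s^{\otimes2}$ has the form $R(\lambda)=\sum_{j=0}^{2s}r_j(\lambda)P^j$ with scalar functions $r_j$, assumed analytic in a neighbourhood of $\lambda=0$. It is regular if $R(0)=\mathbb E$. The Yang–Baxter equation is $$R_{12}(\lambda)R_{23}(\lambda+\mu)R_{12}(\mu)=R_{23}(\mu)R_{12}(\lambda+\mu)R_{23}(\lambda)$$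 on $V_s^{\otimes3}$, the lower indices specifying the tensor factors on which $R$ acts; its solutions are called R-matrices, always normalized by $r_{2s}(\lambda)=1$. ''The $q\to1$ limit of regular $U_q(sl_2)$-invariant R-matrices coincides with $R(\lambda)$'' refers to a family of such R-matrices $R^{(q)}(\lambda)=\sum_j r^{(q)}_j(\lambda)P^j$, $q$ generic near $1$, with $r_j^{(q)}\to r_j$ near $\lambda=0$ (as analytic functions) as $q\to1$, where the $r_j$ are the coefficients of $R(\lambda)$. *)

(* Defs.v *)
From mathcomp Require Import all_boot all_order all_algebra.
From mathcomp Require Import all_classical all_reals all_analysis.
From mathcomp Require Import complex mxtens.

Set Implicit Arguments.
Unset Strict Implicit.
Unset Printing Implicit Defensive.

Import Order.TTheory GRing.Theory Num.Theory numFieldNormedType.Exports.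
Local Open Scope classical_set_scope.
Local Open Scope ring_scope.

(* R[i] carries no topology by itself; seen as an abstract numClosedFieldType
   it inherits the one given by its modulus. *)
Definition Cplx (R : realType) : numClosedFieldType := R[i].

Definition cexp (R : realType) (z : Cplx R) : Cplx R :=
  Complex (expR (complex.Re z) * cos (complex.Im z))
          (expR (complex.Re z) * sin (complex.Im z)).

(* Throughout, [h] is the chosen value of log q, so that q = cexp h. *)
Definition qpow (R : realType) (h t : Cplx R) : Cplx R := cexp (t * h).

Definition qnum (R : realType) (h t : Cplx R) : Cplx R :=
  if cexp h == 1 then t
  else (qpow h t - qpow h (- t)) / (cexp h - (cexp h)^-1).

Definition generic (R : realType) : set (Cplx R) :=
  [set q | q != 0 /\ forall n : nat, (0 < n)%N -> q ^+ n != 1].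

(* The spin s is encoded by N = 2s; the i-th basis vector of V_s is |k> with
   k = i - s.  The basis is normalized by S^+|k> = [s-k]_q |k+1> and
   S^-|k> = [s+k]_q |k-1>.  Matrices act on column vectors. *)
Definition weight (R : realType) (N : nat) (i : 'I_N.+1) : Cplx R :=
  i%:R - N%:R / 2.

Definition Sz (R : realType) (N : nat) : 'M[Cplx R]_N.+1 :=
  diag_mx (\row_i weight R i).

Definition Sp (R : realType) (h : Cplx R) (N : nat) : 'M[Cplx R]_N.+1 :=
  \matrix_(i, j) if i == j.+1 :> nat then qnum h (N - j)%:R else 0.

Definition Sm (R : realType) (h : Cplx R) (N : nat) : 'M[Cplx R]_N.+1 :=
  \matrix_(i, j) if i.+1 == j :> nat then qnum h j%:R else 0.

Definition qSz (R : realType) (h : Cplx R) (N : nat) : 'M[Cplx R]_N.+1 :=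
  diag_mx (\row_i qpow h (weight R i)).

Definition qSzV (R : realType) (h : Cplx R) (N : nat) : 'M[Cplx R]_N.+1 :=
  diag_mx (\row_i qpow h (- weight R i)).

Definition End2 (R : realType) (N : nat) := 'M[Cplx R]_(N.+1 * N.+1).
Definition End3 (R : realType) (N : nat) := 'M[Cplx R]_(N.+1 * N.+1 * N.+1).

Definition DSz (R : realType) (N : nat) : End2 R N :=
  tensmx (Sz R N) 1%:M + tensmx 1%:M (Sz R N).

Definition DSp (R : realType) (h : Cplx R) (N : nat) : End2 R N :=
  tensmx (Sp h N) (qSzV h N) + tensmx (qSz h N) (Sp h N).

Definition DSm (R : realType) (h : Cplx R) (N : nat) : End2 R N :=
  tensmx (Sm h N) (qSzV h N) + tensmx (qSz h N) (Sm h N).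

(* P 0, ..., P N are the projectors of the decomposition of V_s (x) V_s into
   V_0 (+) ... (+) V_{2s}: J j embeds V_j equivariantly, the embeddings form a
   direct sum decomposition with coordinate maps K j, and P j projects onto
   the image of J j along the other images. *)
Definition spin_projectors (R : realType) (h : Cplx R) (N : nat)
    (P : nat -> End2 R N) : Prop :=
  exists (J : forall j : nat, 'M[Cplx R]_(N.+1 * N.+1, (j.*2).+1))
         (K : forall j : nat, 'M[Cplx R]_((j.*2).+1, N.+1 * N.+1)),
  [/\ forall j : nat, (j <= N)%N ->
        [/\ DSz R N *m J j = J j *m Sz R j.*2,
            DSp h N *m J j = J j *m Sp h j.*2
          & DSm h N *m J j = J j *m Sm h j.*2],
      forall j : nat, (j <= N)%N -> K j *m J j = 1%:M,
      forall i j : nat, (i <= N)%N -> (j <= N)%N -> i != j -> K i *m J j = 0,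
      \sum_(j < N.+1) J j *m K j = 1%:M
    & forall j : nat, (j <= N)%N -> P j = J j *m K j].

Definition op12 (R : realType) (N : nat) (A : End2 R N) : End3 R N :=
  tensmx A 1%:M.

Definition op23 (R : realType) (N : nat) (A : End2 R N) : End3 R N :=
  castmx (mulnA _ _ _, mulnA _ _ _) (tensmx (1%:M : 'M[Cplx R]_N.+1) A).

Definition YangBaxter (R : realType) (N : nat) (A : Cplx R -> End2 R N)
    (l m : Cplx R) : Prop :=
  op12 (A l) *m op23 (A (l + m)) *m op12 (A m) =
  op23 (A m) *m op12 (A (l + m)) *m op23 (A l).

Definition Rop (R : realType) (N : nat) (P : nat -> End2 R N)
    (r : nat -> Cplx R -> Cplx R) (l : Cplx R) : End2 R N :=
  \sum_(j < N.+1) r j l *: P j.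

(* f is analytic on the disc |z| < rho: the sum of its power series there. *)
Definition analytic_disc (R : realType) (rho : Cplx R)
    (f : Cplx R -> Cplx R) : Prop :=
  exists c : nat -> Cplx R, forall z : Cplx R, `|z| < rho ->
    series (fun n => c n * z ^+ n) @ \oo --> f z.

(* R-matrices with coefficients analytic on a disc around 0; the values of
   the r_j outside of it are irrelevant. *)
Definition Rmatrix_on (R : realType) (N : nat) (P : nat -> End2 R N)
    (rho : Cplx R) (r : nat -> Cplx R -> Cplx R) : Prop :=
  [/\ 0 < rho,
      forall j : nat, (j <= N)%N -> analytic_disc rho (r j),
      forall l m : Cplx R, `|l| < rho -> `|m| < rho -> `|l + m| < rho ->
        YangBaxter (Rop P r) l m
    & forall l : Cplx R, `|l| < rho -> r N l = 1].

Definition regular (R : realType) (N : nat) (A : Cplx R -> End2 R N) : Prop :=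
  A 0 = 1%:M.

(* A is the q -> 1 limit of a family of regular R-matrices, indexed by the
   generic q near 1.  The values lq q of log q are arbitrary, and P1 are the
   projectors at q = 1.  Convergence of the coefficients as analytic functions
   near 0 is uniform convergence on a disc on which they are all analytic. *)
Definition limit_of_regular_Rmatrices (R : realType) (N : nat)
    (P1 : nat -> End2 R N) (A : Cplx R -> End2 R N) : Prop :=
  exists (lq : Cplx R -> Cplx R) (P : Cplx R -> nat -> End2 R N)
         (r : Cplx R -> nat -> Cplx R -> Cplx R)
         (r1 : nat -> Cplx R -> Cplx R) (rho : Cplx R),
  [/\ 0 < rho,
      forall l : Cplx R, `|l| < rho -> A l = Rop P1 r1 l,
      \forall q \near (1 : Cplx R), generic q ->
        [/\ cexp (lq q) = q, spin_projectors (lq q) (P q),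
            Rmatrix_on (P q) rho (r q) & regular (Rop (P q) (r q))]
    & forall j : nat, (j <= N)%N ->
        {uniform [set l : Cplx R | `|l| < rho],
          (fun q => r q j) @ within (@generic R) (nbhs (1 : Cplx R)) --> r1 j}].

Definition flip (R : realType) (N : nat) : End2 R N :=
  \matrix_(i, j) (((mxtens_unindex i).1 == (mxtens_unindex j).2)
               && ((mxtens_unindex i).2 == (mxtens_unindex j).1))%:R.

Definition R_flip (R : realType) (N : nat) (l : Cplx R) : End2 R N :=
  (1 - l)^-1 *: (1%:M - l *: flip R N).

Definition alpha (R : realType) (N : nat) : Cplx R :=
  N%:R / 2 + 1 / 2 + (-1) ^+ N.+1.

Definition beta (R : realType) (N : nat) : Cplx R :=
  N.+1%:R * (-1) ^+ N.+1.

Definition R_flip0 (R : realType) (N : nat) (P1 : nat -> End2 R N)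
    (l : Cplx R) : End2 R N :=
  (1 - l)^-1 *: (1%:M - l *: flip R N
                 + (beta R N * l / (l - alpha R N)) *: P1 0%N).

(* Main.v *)
Require Import Defs.
From mathcomp Require Import all_boot all_order all_algebra.
From mathcomp Require Import all_classical all_reals all_analysis.
From mathcomp Require Import complex mxtens.
From mathcomp Require Import ring zify.

Set Implicit Arguments.
Unset Strict Implicit.
Unset Printing Implicit Defensive.

Import Order.TTheory GRing.Theory Num.Theory numFieldNormedType.Exports.
Local Open Scope classical_set_scope.
Local Open Scope ring_scope.

(** Why the theorem holds.  Write N = 2s, Q = q^2, T = q^(2N), and let v_k be
    the highest weight vector of weight N - k in the tensor square of V_s.  An
    invariant R(l) multiplies v_k by r_(N-k)(l), so only the r_j with j close to
    N = 2s enter the Yang-Baxter equation near the top weight of the tensor cube.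

    On the tensor cube consider the linear functionals that vanish on the image
    of the total lowering operator.  They are preserved by R_12 and by R_23, and
    on the vectors lying n steps below the top weight they form a space of
    dimension n + 1.  Such a functional is described equally well by its values
    on the vectors v_k (x) e_(n-k), which diagonalize R_12, and by its values on
    the vectors e_(n-l) (x) v_l, which diagonalize R_23; the two descriptions are
    related by a matrix of q-6j symbols whose entries are rational in T and Q
    ([left_of_right], [right_of_left]).  Hence the Yang-Baxter equation taken at
    the single pair (l, l) amounts to polynomial identities between the numbers
    r_(N-k)(l) and r_(N-k)(2l), k <= n ([yb_sum_eq0], [YangBaxter_yb_sum]).

    Parametrize r_(N-1)(l) = (T Z - 1) / (T - Z).
    - For n = 1 the equation is linear in r_(N-1)(2l) and gives the same
      expression with Z^2 in place of Z.
    - For n = 2, eliminating r_(N-2)(2l) leaves a product of two factors: either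
      r_(N-2)(l) has the announced value, or it equals (T^2 Z + Q) / (T^2 + Q Z),
      and then r_(N-2)(2l) is again the same expression at Z^2.
    - For n = 3, in the second case, the equations are linear in r_(N-3)(l) and
      r_(N-3)(2l); they determine both, and a further equation then reduces to a
      nonzero constant.  So the second case does not occur.
    This is [second_ratio_forced].

    For the first assertion Z = q^(2l), which is close to but different from 1
    for small nonzero l.  For the second one, both limiting R-matrices have
    r_(2s-1)(l) = (1 + l) / (1 - l) and r_(2s-2)(l) = 1, because the permutation
    changes the sign of v_1, fixes v_2, and P^0 kills both.  Fix a small l > 0
    and solve for Z in terms of T and x = r_(2s-1)(l).  The relation between
    r_(2s-2)(l) and x then contains the factor Q - 1; after dividing by it, the
    limit q -> 1 reads (2N - 1)(1 - x^2) = 0, which is false. *)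

(** * Yang-Baxter sums and recoupling tables *)

(** The entry (i, j) of A D B D' A D - D A D' B D A, where A and B are both
    proportional to the matrix (L_i N_ij), D = diag(d) and D' = diag(D), stripped
    of the factors that depend on i and j only.  The outer diagonal factors are
    recorded separately as [c], so that [c], [d] and [D] can be rescaled
    independently to clear denominators. *)
Definition yb_sum (F : fieldType) (n : nat) (N : nat -> nat -> F)
    (L c d D : nat -> F) (i j : nat) : F :=
  \sum_(k < n.+1) \sum_(l < n.+1)
    N i k * N k l * N l j * (L k * L l) * (c j * d k * D l - c i * D k * d l).

Lemma yb_sum2E (F : fieldType) N (L c d D : nat -> F) i j
    (f := fun k l => N i k * N k l * N l j * (L k * L l)
                     * (c j * d k * D l - c i * D k * d l)) :
  yb_sum 2 N L c d D i j =
    f 0%N 0%N + f 0%N 1%N + f 0%N 2%N + f 1%N 0%N + f 1%N 1%N + f 1%N 2%N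
    + f 2%N 0%N + f 2%N 1%N + f 2%N 2%N.
Proof. by rewrite /yb_sum !big_ord_recl !big_ord0 /= /bump /= !addr0 !addrA. Qed.

Lemma yb_sum3E (F : fieldType) N (L c d D : nat -> F) i j
    (f := fun k l => N i k * N k l * N l j * (L k * L l)
                     * (c j * d k * D l - c i * D k * d l)) :
  yb_sum 3 N L c d D i j =
    f 0%N 0%N + f 0%N 1%N + f 0%N 2%N + f 0%N 3%N + f 1%N 0%N + f 1%N 1%N
    + f 1%N 2%N + f 1%N 3%N + f 2%N 0%N + f 2%N 1%N + f 2%N 2%N + f 2%N 3%N
    + f 3%N 0%N + f 3%N 1%N + f 3%N 2%N + f 3%N 3%N.
Proof. by rewrite /yb_sum !big_ord_recl !big_ord0 /= /bump /= !addr0 !addrA. Qed.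

Lemma yb_sum_scale (F : fieldType) n N (L c d D c' d' D' : nat -> F)
    (s1 s2 s3 : F) i j :
  c' i = s1 * c i -> c' j = s1 * c j ->
  (forall k, (k <= n)%N -> d' k = s2 * d k) ->
  (forall k, (k <= n)%N -> D' k = s3 * D k) ->
  yb_sum n N L c d D i j = 0 -> yb_sum n N L c' d' D' i j = 0.
Proof.
move=> hi hj hd hD h0.
suff -> : yb_sum n N L c' d' D' i j = s1 * s2 * s3 * yb_sum n N L c d D i j.
  by rewrite h0 mulr0.
rewrite /yb_sum mulr_sumr; apply: eq_bigr => k _.
rewrite mulr_sumr; apply: eq_bigr => l _.
by rewrite hi hj !hd ?hD ?(leq_ord k) ?(leq_ord l) //; ring.
Qed.

Definition table (F : fieldType) (rows : seq (seq F)) (i j : nat) : F :=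
  nth 0 (nth [::] rows i) j.

Section Tables.
Variables (F : fieldType) (T Q : F).

(** Numerators of the q-6j symbols that recouple three copies of V_s, n steps
    below the top weight, for n = 1, 2, 3. *)
Definition sixj1 : seq (seq F) := [:: [:: 1; T^+2 + T + 1]; [:: 1; - T]].

Definition sixj2 : seq (seq F) :=
 [:: [:: (T - 1)*(T - Q); (T^+3 - Q)*(T - Q); (T^+3 - Q)*(T^+3 - Q^+2)];
     [:: (T - 1)^+2*(1 + Q); (T - 1)*(T - Q)*(T^+2 + Q);
         - T*(T^+3 - Q^+2)*(1 + Q)*(T - 1)];
     [:: (T - 1)*(T - Q); - T*(T - Q)^+2; T^+2*Q*(T - 1)*(T - Q)]].

Definition sixj3 : seq (seq F) :=
 [:: [:: (T - 1)*(T - Q)*(T - Q^+2);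
         (T^+3 - Q^+2)*(T - Q)*(T - Q^+2);
         (T^+3 - Q^+2)*(T^+3 - Q^+3)*(T - Q^+2);
         (T^+3 - Q^+2)*(T^+3 - Q^+3)*(T^+3 - Q^+4)];
     [:: (T - 1)^+2*(T - Q)*(1 + Q + Q^+2);
         (T - 1)*(T - Q)*(Q*(T^+3 - Q^+2) + (T^+3 - Q^+4) - T*Q^+2*(T - 1));
         (T - 1)*(T - Q)*(T - Q^+2)*(T^+4 + T^+2*Q^+2 + Q^+4);
         - T*(T^+3 - Q^+3)*(T^+3 - Q^+4)*(T - 1)*(1 + Q + Q^+2)];
     [:: (T - 1)^+2*(T - Q)*(1 + Q + Q^+2);
         (T - 1)*(T - Q)*(T - Q^+2)*(T^+2 - T*Q + Q^+2);
         - T*(T - Q)*(T - Q^+2)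
           *(Q*(T^+3 - Q^+2) + (T^+3 - Q^+4) - T*Q*(T - Q^+2));
         T^+2*Q*(T^+3 - Q^+4)*(T - 1)*(T - Q)*(1 + Q + Q^+2)];
     [:: (T - 1)*(T - Q)*(T - Q^+2);
         - T*(T - Q)*(T - Q^+2)^+2;
         T^+2*Q*(T - Q)*(T - Q^+2)^+2;
         - T^+3*Q^+3*(T - 1)*(T - Q)*(T - Q^+2)]].

(** The denominators of the rows of these tables, all brought to the common
    denominator [sixj_den n]: the symbol with indices i, j is
    [sixj_weight n i * sixj n i j / sixj_den n]. *)
Definition weight1 : seq F := [:: T; 1].
Definition weight2 : seq F :=
  [:: T^+2*(T^+2 - Q^+2); T*(T^+2 - Q); T^+2 - 1].
Definition weight3 : seq F :=
  [:: T^+3*(T^+2 - Q^+3)*(T^+2 - Q^+4); T^+2*(T^+2 - Q)*(T^+2 - Q^+4);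
      T*(T^+2 - 1)*(T^+2 - Q^+3); (T^+2 - 1)*(T^+2 - Q)].

Definition sixj n : nat -> nat -> F :=
  nth (fun _ _ => 0)
    [:: fun _ _ => 0; table sixj1; table sixj2; table sixj3] n.
Definition sixj_weight n : nat -> F :=
  nth (fun _ => 0)
    [:: fun _ => 0; nth 0 weight1; nth 0 weight2; nth 0 weight3] n.
Definition sixj_den n : F :=
  nth 0 [:: 1; T * (T + 1); T^+2 * (T^+2 - 1) * (T^+2 - Q) * (T^+2 - Q^+2);
    T^+3 * (T^+2 - 1) * (T^+2 - Q) * (T^+2 - Q^+2) * (T^+2 - Q^+3)
    * (T^+2 - Q^+4)] n.

(** Every factor in T and Q alone that has to be invertible below divides one of
    these elements; for T = q^(2N) and Q = q^2 each of them is, up to a power of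
    q, a difference of two distinct powers of q. *)
Definition nondeg : bool :=
  all (fun u => u != 0) [:: T; Q^+2 - 1; T^+2 - 1; T^+3 - 1; T^+6 - Q^+6;
    T^+2 - Q^+4; T^+2 - Q; T^+2 - Q^+3; T^+3 - Q; T^+3 - Q^+2; T^+3 - Q^+4;
    T^+2 * Q^+2 - 1].

Lemma nondeg_neq0 : nondeg -> T != 0.
Proof. by case/andP. Qed.

Lemma nondeg_factors : nondeg ->
  [/\ [/\ T - 1 != 0, T + 1 != 0 & T^+2 + T + 1 != 0],
      [/\ T - Q != 0, T + Q != 0, T^+2 + T * Q + Q^+2 != 0
        & T^+2 - T * Q + Q^+2 != 0],
      T - Q^+2 != 0 /\ T + Q^+2 != 0
    & Q + 1 != 0 /\ T * Q + 1 != 0].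
Proof.
rewrite /nondeg /= andbT => /and5P[_ Q2 T2 T3] /and5P[T6 T2Q4 _ _].
move=> /and4P[_ _ _ TQ].
have split2 (u v w : F) : u * v = w -> w != 0 -> u != 0 /\ v != 0.
  by move=> <-; rewrite mulf_eq0 negb_or => /andP.
have [T1 T1'] : T - 1 != 0 /\ T + 1 != 0 by apply: split2 T2; ring.
have [_ T3'] : T - 1 != 0 /\ T^+2 + T + 1 != 0 by apply: split2 T3; ring.
have [T6a T6b] : (T - Q) * (T + Q) != 0 /\
    (T^+2 + T * Q + Q^+2) * (T^+2 - T * Q + Q^+2) != 0.
  by apply: split2 T6; ring.
have [TmQ TpQ] := split2 _ _ _ erefl T6a.
have [TqQ TrQ] := split2 _ _ _ erefl T6b.
have [TmQ2 TpQ2] : T - Q^+2 != 0 /\ T + Q^+2 != 0 by apply: split2 T2Q4; ring.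
have [_ TQ1] : T * Q - 1 != 0 /\ T * Q + 1 != 0 by apply: split2 TQ; ring.
have [_ Q1] : Q - 1 != 0 /\ Q + 1 != 0 by apply: split2 Q2; ring.
by split.
Qed.

Lemma nondeg_squares : nondeg ->
  [/\ T^+2 - 1 != 0, T^+2 - Q != 0, T^+2 - Q^+2 != 0, T^+2 - Q^+3 != 0
    & T^+2 - Q^+4 != 0].
Proof.
move=> nd; have [_ [TmQ TpQ _ _] _ _] := nondeg_factors nd.
move: nd; rewrite /nondeg /= => /and5P[_ _ T2 _] /and5P[_ T2Q4 T2Q T2Q3] _.
by split=> //; rewrite subr_sqr mulf_neq0.
Qed.

Lemma sixj_den_neq0 n : nondeg -> (0 < n <= 3)%N -> sixj_den n != 0.
Proof.
move=> nd; have T0 := nondeg_neq0 nd; have [[_ T1 _] _ _ _] := nondeg_factors nd.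
have [h1 h2 h3 h4 h5] := nondeg_squares nd.
by case: n => [|[|[|[|]]]] // _; rewrite /sixj_den /= !mulf_neq0 ?expf_neq0.
Qed.

Lemma sixj_weight_neq0 n k : nondeg -> (0 < n <= 3)%N -> (k <= n)%N ->
  sixj_weight n k != 0.
Proof.
move=> nd; have T0 := nondeg_neq0 nd; have [h1 h2 h3 h4 h5] := nondeg_squares nd.
by case: n => [|[|[|[|]]]] // _; case: k => [|[|[|[|]]]] // _;
  rewrite /sixj_weight /= ?mulf_neq0 ?expf_neq0 ?oner_eq0.
Qed.

End Tables.

(** * Eliminating the unknowns *)

(** The identities of this section are certificates: explicit combinations of
    Yang-Baxter sums that factor.  Throughout, the vectors of ratios are
    multiplied by their common denominator, so that [z] and [y] stand for the
    last unknown ratio at l and at 2l times that denominator. *)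
Section Certificates.
Variables (F : fieldType) (T Q Z : F).

Lemma level1_factor (X : F) :
  yb_sum 1 (table (sixj1 T)) (nth 0 (weight1 T)) (nth 0 [:: T - Z; T * Z - 1])
    (nth 0 [:: T - Z; T * Z - 1]) (nth 0 [:: 1; X]) 0 1
  = (T^+2 + T + 1) * T * (T + 1)^+2 * (T - 1)
    * (T * Z ^+ 2 - 1 - X * (T - Z^+2)).
Proof. by rewrite /yb_sum !big_ord_recl !big_ord0 /table /=; ring. Qed.

Definition level2 y z := yb_sum 2 (table (sixj2 T Q)) (nth 0 (weight2 T Q))
   (nth 0 [:: T - Z; T * Z - 1; z]) (nth 0 [:: T - Z; T * Z - 1; z])
   (nth 0 [:: T - Z^+2; T * Z^+2 - 1; y]).

(** Both level 2 equations are affine in [y]; eliminating it leaves a quadratic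
    polynomial in [z] that splits into linear factors. *)
Lemma level2_eliminate y z :
  (T - Q)*(T + 1)*(Z - 1) * level2 y z 0 2
    - ((T^+3-Q^+2)*(Z-T) - (T-1)*T*Q * z) * level2 y z 0 1 =
  T^+2 * (T-Q)^+3*(T+Q)*(T-1)^+3*(T+1)^+3*(T^+2-Q)*(T^+3-Q^+2)*(T^+3-Q)*(Z-1)
    * (z * (T - Q * Z) - (T * Z - 1) * (T * Z - Q))
    * (z * (T^+2 + Q * Z) - (T^+2 * Z + Q) * (T - Z)).
Proof. by rewrite /level2 !yb_sum2E /table /=; ring. Qed.

Definition lead2 :=
  (T-Q)^+3*(T-1)^+3*(T+1)^+3*(T^+3-Q^+2)*(T^+3-Q)*(Z-1) * T^+2.
Definition pole2 := T^+3 + T^+2*Q*Z + T^+2*Q - T*Q*Z - T*Q - Q^+2*Z.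

(** As an equation for [y], the first level 2 equation has a leading coefficient
    that cannot vanish at a solution: if it did, the equation would reduce to
    the last term, which is nonzero. *)
Lemma level2_singular y z :
  T * Q * level2 y z 0 1 =
   (pole2 - T*Q*z) * (T*Q*lead2*y - (level2 0 1 0 1 - level2 0 0 0 1))
     - lead2 * Z * (T+Q)^+2*(T^+2-Q)^+2*(Z+1).
Proof. by rewrite /level2 /pole2 /lead2 !yb_sum2E /table /=; ring. Qed.

(** When [z] is a zero of the second factor of [level2_eliminate], the first
    level 2 equation says that [y] is given by the same formula at Z^2. *)
Lemma level2_branch y z :
  (T^+2 + Q*Z) * level2 y z 0 1 =
   (level2 0 1 0 1 - level2 0 0 0 1 - T * Q * lead2 * y)
     * (z * (T^+2 + Q * Z) - (T^+2 * Z + Q) * (T - Z))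
   + lead2 * (T+Q)*(T^+2-Q)
     * (y * (T^+2 + Q * Z^+2) - (T^+2 * Z^+2 + Q) * (T - Z^+2)).
Proof. by rewrite /level2 /pole2 /lead2 !yb_sum2E /table /=; ring. Qed.

(** The ratios at l and 2l in the second case, the fourth being unknown. *)
Definition branch_d z :=
  nth 0 [:: (T - Z) * (T^+2 + Q * Z); (T * Z - 1) * (T^+2 + Q * Z);
            (T^+2 * Z + Q) * (T - Z); z].
Definition branch_D y :=
  nth 0 [:: (T - Z^+2) * (T^+2 + Q * Z^+2); (T * Z^+2 - 1) * (T^+2 + Q * Z^+2);
            (T^+2 * Z^+2 + Q) * (T - Z^+2); y].
Definition level3 y z := yb_sum 3 (table (sixj3 T Q)) (nth 0 (weight3 T Q))
  (branch_d z) (branch_d z) (branch_D y).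

Definition qint3 := Q^+2 + Q + 1.

(** The third ratio that level 3 forces in the second case, at parameter W, is
    [third_num W / third_den W] times the common denominator of [branch_d]. *)
Definition third_num (W : F) :=
  qint3 * (Q^+2 * W - T^+3) * ((T - W) * (T^+2 + Q * W))
  + (W - 1) * (T^+3 + Q^+3)
    * (qint3 * (W^+2 - T^+3) - W * (T^+3 - (1+Q)*T^+2 + Q*(1+Q)*T - Q^+2)).
Definition third_den (W : F) := qint3 * (Q^+2 * W - T^+3).

Definition lead3 :=
  (T - Q^+2)^+3*(T + Q^+2)*(T - Q)^+3*(T + Q)^+2*(T^+2 + T*Q + Q^+2)
  * (T - 1)^+3*(T + 1)^+3 * (T^+2 - Q^+3)*(T^+2 - Q)^+3*(T^+3 - Q^+4)
  * (T^+3 - Q^+2)*(Z - 1)^+2 * T^+4.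

Lemma level3_solve_d y z :
  T^+2*Q*qint3*(T-1)*(Z-T)*(T^+2*Z+Q) * level3 y z 0 1
  - T * qint3*(T-1)*(T^+2+Q*Z)*(T*Z-1) * level3 y z 0 2
  + (T^+3-Q^+2)*(T^+2+Q*Z)*(Z-T) * level3 y z 1 2
  = lead3 * Z * (T^+2+Q*Z) * (Z - T) * (Z+1) * (third_den Z * z - third_num Z).
Proof.
by rewrite /level3 !yb_sum3E /branch_d /branch_D /table /third_den /third_num
  /lead3 /qint3 /=; ring.
Qed.

Lemma level3_solve_D y z :
  T^+2*Q*qint3*(T-1) * level3 y z 0 1 + T * qint3*(T-1) * level3 y z 0 2
  + (T^+3-Q^+2) * level3 y z 1 2
  = lead3 * (third_den (Z^+2) * y - third_num (Z^+2)).
Proof.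
by rewrite /level3 !yb_sum3E /branch_d /branch_D /table /third_den /third_num
  /lead3 /qint3 /=; ring.
Qed.

(** With the forced third ratios inserted and all denominators cleared, a level 3
    equation becomes a product of nonzero factors. *)
Lemma level3_residue :
  yb_sum 3 (table (sixj3 T Q)) (nth 0 (weight3 T Q)) (branch_d 0)
    (nth 0 [:: third_den Z * branch_d 0 0; third_den Z * branch_d 0 1;
               third_den Z * branch_d 0 2; third_num Z])
    (nth 0 [:: third_den (Z^+2) * branch_D 0 0; third_den (Z^+2) * branch_D 0 1;
               third_den (Z^+2) * branch_D 0 2; third_num (Z^+2)]) 0 1 =
  - T*Z^+3 * (Q + 1) * (T + Q^+2)^+2 * (T + Q)^+2 * (T^+2 - T*Q + Q^+2)
    * (T + 1)*(T*Q + 1) * (T^+2 - Q^+3)^+2 * (Z+1) * (Z-1)^+2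
    * ((T-Q^+2)^+3*(T-Q)^+3*(T^+2+T*Q+Q^+2)*(T-1)^+3*(T+1)^+3*(T^+2-Q)^+2
       *(T^+3-Q^+4)*(T^+3-Q^+2)*(T^+2+Q*Z)*(Z-1)*T^+3).
Proof.
by rewrite !yb_sum3E /table /branch_d /branch_D /third_den /third_num /qint3 /=;
  ring.
Qed.
End Certificates.

(** The algebraic heart of the proof: the ratios d_k = r_(N-k)(l) and
    D_k = r_(N-k)(2l) of a solution are so constrained by levels 1, 2 and 3 that
    d_1 determines d_2. *)
Lemma second_ratio_forced (F : fieldType) (T Q Z : F) (d D : nat -> F) :
  nondeg T Q -> Z != 0 -> Z != 1 -> Z != -1 -> T != Z ->
  T^+2 + Q*Z != 0 -> T^+2 + Q*Z^+2 != 0 ->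
  d 0%N = 1 -> D 0%N = 1 -> d 1%N * (T - Z) = T * Z - 1 ->
  (forall n i j, (0 < n <= 3)%N -> (i <= n)%N -> (j <= n)%N ->
     yb_sum n (sixj T Q n) (sixj_weight T Q n) d d D i j = 0) ->
  d 2%N * (T - Z) * (T - Q * Z) = (T * Z - 1) * (T * Z - Q).
Proof.
move=> nd Z0 Z1 Zm1; rewrite -(subr_eq0 T) => TZ TQZ TQZ2 d0 D0 dx yb.
have T0 := nondeg_neq0 nd.
have [[Tm Tp Tq] [TmQ TpQ TqQ TrQ] [TmQ2 TpQ2] [Q1 TQ1]] := nondeg_factors nd.
have [T2 T2Q _ T2Q3 T2Q4] := nondeg_squares nd.
move: nd; rewrite /nondeg /= andbT => /and5P[_ _ _ _] /and5P[_ _ _ _].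
move=> /and4P[T3Q T3Q2 T3Q4 _].
have Zm1' : Z + 1 != 0 by rewrite -[1]opprK subr_eq0.
have Z1' : Z - 1 != 0 by rewrite subr_eq0.
have cancel (u v : F) : u * v = 0 -> u != 0 -> v = 0.
  by move=> /eqP; rewrite mulf_eq0 => /orP[/eqP-> /eqP|/eqP].
have TZ2X : D 1%N * (T - Z^+2) = T * Z^+2 - 1.
  apply/esym/eqP; rewrite -subr_eq0; apply/eqP.
  have hd k : (k <= 1)%N -> nth 0 [:: T - Z; T * Z - 1] k = (T - Z) * d k.
    by case: k => [|[|]] //= _; rewrite ?d0 ?mulr1 // -dx mulrC.
  have hD k : (k <= 1)%N -> nth 0 [:: 1; D 1%N] k = 1 * D k.
    by case: k => [|[|]] //= _; rewrite ?D0 mul1r.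
  have yb1 := yb 1%N 0%N 1%N isT isT isT.
  have := yb_sum_scale (hd 0%N isT) (hd 1%N isT) hd hD yb1.
  by rewrite level1_factor => /cancel; apply; rewrite !mulf_neq0 ?expf_neq0.
have TZ2 : T - Z^+2 != 0.
  apply/eqP => e; have eT : T = Z^+2 by apply/eqP; rewrite -subr_eq0 e.
  by move: TZ2X; rewrite e mulr0 -eT -expr2 => /eqP; rewrite eq_sym (negPf T2).
pose z := (T - Z) * d 2%N; pose y := (T - Z^+2) * D 2%N.
have hE2 j : (0 < j <= 2)%N -> level2 T Q Z y z 0 j = 0.
  move=> /andP[_ hj].
  have hd k : (k <= 2)%N -> nth 0 [:: T - Z; T * Z - 1; z] k = (T - Z) * d k.
    by case: k => [|[|[|]]] //= _; rewrite ?d0 ?mulr1 // -dx mulrC.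
  apply: (yb_sum_scale (hd 0%N isT) (hd j hj) hd _ (yb 2%N 0%N j isT isT hj)).
  by case=> [|[|[|]]] //= _; rewrite ?D0 ?mulr1 // -TZ2X mulrC.
have e1 := hE2 1%N isT; have e2 := hE2 2%N isT.
have lead20 : lead2 T Q Z != 0 by rewrite /lead2 !mulf_neq0 ?expf_neq0.
have ndz : pole2 T Q Z - T * Q * z != 0.
  apply/eqP => e; have := level2_singular T Q Z y z.
  rewrite e1 e mul0r mulr0 sub0r => /eqP.
  by rewrite eq_sym oppr_eq0; apply/negP; rewrite !mulf_neq0 ?expf_neq0.
have := level2_eliminate T Q Z y z; rewrite e1 e2 !mulr0 subrr => /esym/eqP.
rewrite mulf_eq0 => /orP[|]; last first.
  move=> /eqP hG; exfalso.
  have hY : y * (T^+2 + Q * Z^+2) = (T^+2 * Z^+2 + Q) * (T - Z^+2).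
    have := level2_branch T Q Z y z.
    rewrite e1 hG !mulr0 add0r => /esym/cancel h.
    by apply/eqP; rewrite -subr_eq0 h // !mulf_neq0.
  pose z3 := (T - Z) * (T^+2 + Q * Z) * d 3%N.
  pose y3 := (T - Z^+2) * (T^+2 + Q * Z^+2) * D 3%N.
  have hd k : (k <= 3)%N ->
      branch_d T Q Z z3 k = (T - Z) * (T^+2 + Q * Z) * d k.
    rewrite /branch_d; case: k => [|[|[|[|]]]] //= _; rewrite ?d0 ?mulr1 //.
      by rewrite -dx; ring.
    by move/eqP: hG; rewrite subr_eq0 => /eqP <-; rewrite /z; ring.
  have hD k : (k <= 3)%N ->
      branch_D T Q Z y3 k = (T - Z^+2) * (T^+2 + Q * Z^+2) * D k.
    rewrite /branch_D; case: k => [|[|[|[|]]]] //= _; rewrite ?D0 ?mulr1 //.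
      by rewrite -TZ2X; ring.
    by rewrite -hY /y; ring.
  have hE3 i j : (i <= 3)%N -> (j <= 3)%N -> level3 T Q Z y3 z3 i j = 0.
    move=> li lj.
    by apply: (yb_sum_scale (hd i li) (hd j lj) hd hD (yb 3%N i j isT li lj)).
  have lead30 : lead3 T Q Z != 0 by rewrite /lead3 !mulf_neq0 ?expf_neq0.
  have hz : third_den T Q Z * z3 = third_num T Q Z.
    have := level3_solve_d T Q Z y3 z3.
    rewrite !hE3 // !mulr0 subrr addr0 => /esym/cancel h.
    apply/eqP; rewrite -subr_eq0 h // !mulf_neq0 //.
    by rewrite -opprB oppr_eq0.
  have hy : third_den T Q (Z^+2) * y3 = third_num T Q (Z^+2).
    have := level3_solve_D T Q Z y3 z3.
    rewrite !hE3 // !mulr0 !addr0 => /esym/cancel h.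
    by apply/eqP; rewrite -subr_eq0 h.
  have := level3_residue T Q Z.
  (* the rescaling by third_den is legitimate even where third_den vanishes,
     since only the vanishing of the sum is transported *)
  rewrite (@yb_sum_scale _ _ _ _ _ _ _ _ _ _ 1 (third_den T Q Z)
    (third_den T Q (Z^+2)) _ _ _ _ _ _ (hE3 0%N 1%N isT isT)).
  - by move/esym/eqP; apply/negP; rewrite !mulf_neq0 ?oppr_eq0 ?expf_neq0.
  - by rewrite mul1r.
  - by rewrite mul1r.
  - by case=> [|[|[|[|]]]] //= _; rewrite -hz.
  - by case=> [|[|[|[|]]]] //= _; rewrite -hy.
move=> /eqP/cancel h.
have /eqP : z * (T - Q * Z) - (T * Z - 1) * (T * Z - Q) = 0.
  by apply: h; rewrite !mulf_neq0 ?expf_neq0.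
by rewrite subr_eq0 => /eqP <-; rewrite /z; ring.
Qed.

(** * Coinvariant functionals in coordinates *)

Section Coinvariants.
Variables (F : fieldType) (T Q : F).
Implicit Type P : nat -> nat -> nat -> F.

(** Let e_a be the vector of V_s that lies a steps below the top.  A functional
    on the tensor cube is encoded by the array P of its values on e_a (x) e_b
    (x) e_c divided by q^(N b); up to a unit, [coinvariance P a b c] is its value
    on the total lowering of that vector ([coord3_Sm3_coinvariance]). *)
Definition coinvariance P a b c : F :=
  Q^+(b + c) * (T - Q^+a) * P a.+1 b c + T * Q^+c * (T - Q^+b) * P a b.+1 c
  + T * (T - Q^+c) * P a b c.+1.

(** Row k lists the coefficients of the polynomial (1 - X)(Q - X)...(Q^(k-1) - X);
    by the q-binomial theorem multiplying the m-th one by q^(N m) gives the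
    coefficients of the highest weight vector v_k. *)
Definition hw_coef : nat -> nat -> F :=
  table [:: [:: 1]; [:: 1; -1]; [:: Q; - (1 + Q); 1];
            [:: Q^+3; - (Q + Q^+2 + Q^+3); 1 + Q + Q^+2; -1]].

(** Normalizations for which both recouplings below are given by the same table. *)
Definition left_scale : nat -> nat -> F :=
  table [:: [::]; [:: 1; T]; [:: 1; T * Q; T^+2 * Q];
            [:: 1; T * Q^+2; T^+2 * Q^+3; T^+3 * Q^+3]].
Definition right_scale : nat -> nat -> F :=
  table [:: [::]; [:: -1; T]; [:: Q; - (T * Q); T^+2 * Q];
            [:: - Q^+3; T * Q^+3; - (T^+2 * Q^+3); T^+3 * Q^+3]].

(** The values of the functional on multiples of v_k (x) e_(n-k) and of
    e_(n-l) (x) v_l ([left_vecE], [right_vecE]). *)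
Definition left_value P n k : F :=
  left_scale n k * \sum_(m < k.+1) hw_coef k m * P m (k - m)%N (n - k)%N.
Definition right_value P n l : F :=
  right_scale n l * \sum_(m < l.+1) T^+m * hw_coef l m * P (n - l)%N m (l - m)%N.

Hypotheses (Q0 : Q != 0) (nd : nondeg T Q).

Let T0 : T != 0 := nondeg_neq0 nd.
Let Tm1 : T - 1 != 0. Proof. by have [[]] := nondeg_factors nd. Qed.
Let TmQ : T - Q != 0. Proof. by have [_ []] := nondeg_factors nd. Qed.
Let TmQ2 : T - Q^+2 != 0. Proof. by have [_ _ []] := nondeg_factors nd. Qed.

Let T_Qexp b : (b <= 2)%N -> T - Q^+b != 0.
Proof. by case: b => [|[|[|]]]. Qed.

(** The middle index can be lowered, so the values P m 0 (n - m) determine P on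
    all indices of sum n. *)
Lemma coinvariance_solve P a b c : (b <= 2)%N -> coinvariance P a b c = 0 ->
  P a b.+1 c =
    - (Q^+(b + c) * (T - Q^+a) * P a.+1 b c + T * (T - Q^+c) * P a b c.+1)
    / (T * Q^+c * (T - Q^+b)).
Proof.
move=> /T_Qexp Tb h; apply: (@mulIf _ (T * Q^+c * (T - Q^+b))).
  by rewrite !mulf_neq0 ?expf_neq0.
rewrite divfK ?mulf_neq0 ?expf_neq0 //; apply/eqP; rewrite -subr_eq0 -h; apply/eqP.
by rewrite /coinvariance; ring.
Qed.

Section Recoupling.
Variable P : nat -> nat -> nat -> F.
Hypothesis HP : forall a b c, coinvariance P a b c = 0.

Local Ltac unfold_values :=
  rewrite /left_value /right_value !(big_ord_recl, big_ord0) /= /bump /=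
    /hw_coef /sixj /sixj_weight /sixj_den /left_scale /right_scale /table /=
    !(addn0, add0n, subn0, subnn, subSS) /=.
Local Ltac nonzero := rewrite ?Q0 ?T0 ?Tm1 ?TmQ ?TmQ2.

Lemma left_of_right1 j : (j <= 1)%N ->
  sixj_den T Q 1 * left_value P 1 j =
  \sum_(l < 2) sixj_weight T Q 1 l * sixj T Q 1 l j * right_value P 1 l.
Proof.
have e1 := @coinvariance_solve P 0 0 0 isT (HP _ _ _).
by case: j => [|[|]] //= _; unfold_values; rewrite ?e1; field; nonzero.
Qed.

Lemma right_of_left1 j : (j <= 1)%N ->
  sixj_den T Q 1 * right_value P 1 j =
  T * \sum_(l < 2) sixj_weight T Q 1 l * sixj T Q 1 l j * left_value P 1 l.
Proof.
have e1 := @coinvariance_solve P 0 0 0 isT (HP _ _ _).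
by case: j => [|[|]] //= _; unfold_values; rewrite ?e1; field; nonzero.
Qed.

Lemma left_of_right2 j : (j <= 2)%N ->
  sixj_den T Q 2 * left_value P 2 j =
  \sum_(l < 3) sixj_weight T Q 2 l * sixj T Q 2 l j * right_value P 2 l.
Proof.
have e1 := @coinvariance_solve P 1 0 0 isT (HP _ _ _).
have e2 := @coinvariance_solve P 0 0 1 isT (HP _ _ _).
have e3 := @coinvariance_solve P 0 1 0 isT (HP _ _ _).
by case: j => [|[|[|]]] //= _; unfold_values; rewrite ?e3 ?e1 ?e2; field; nonzero.
Qed.

Lemma right_of_left2 j : (j <= 2)%N ->
  sixj_den T Q 2 * right_value P 2 j =
  T^+2 * \sum_(l < 3) sixj_weight T Q 2 l * sixj T Q 2 l j * left_value P 2 l.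
Proof.
have e1 := @coinvariance_solve P 1 0 0 isT (HP _ _ _).
have e2 := @coinvariance_solve P 0 0 1 isT (HP _ _ _).
have e3 := @coinvariance_solve P 0 1 0 isT (HP _ _ _).
by case: j => [|[|[|]]] //= _; unfold_values; rewrite ?e3 ?e1 ?e2; field; nonzero.
Qed.

Lemma left_of_right3 j : (j <= 3)%N ->
  sixj_den T Q 3 * left_value P 3 j =
  \sum_(l < 4) sixj_weight T Q 3 l * sixj T Q 3 l j * right_value P 3 l.
Proof.
have e1 := @coinvariance_solve P 2 0 0 isT (HP _ _ _).
have e2 := @coinvariance_solve P 1 0 1 isT (HP _ _ _).
have e3 := @coinvariance_solve P 0 0 2 isT (HP _ _ _).
have e4 := @coinvariance_solve P 1 1 0 isT (HP _ _ _).
have e5 := @coinvariance_solve P 0 1 1 isT (HP _ _ _).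
have e6 := @coinvariance_solve P 0 2 0 isT (HP _ _ _).
by case: j => [|[|[|[|]]]] //= _; unfold_values;
  rewrite ?e6 ?e5 ?e4 ?e3 ?e1 ?e2; field; nonzero.
Qed.

Lemma right_of_left3 j : (j <= 3)%N ->
  sixj_den T Q 3 * right_value P 3 j =
  T^+3 * \sum_(l < 4) sixj_weight T Q 3 l * sixj T Q 3 l j * left_value P 3 l.
Proof.
have e1 := @coinvariance_solve P 2 0 0 isT (HP _ _ _).
have e2 := @coinvariance_solve P 1 0 1 isT (HP _ _ _).
have e3 := @coinvariance_solve P 0 0 2 isT (HP _ _ _).
have e4 := @coinvariance_solve P 1 1 0 isT (HP _ _ _).
have e5 := @coinvariance_solve P 0 1 1 isT (HP _ _ _).
have e6 := @coinvariance_solve P 0 2 0 isT (HP _ _ _).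
by case: j => [|[|[|[|]]]] //= _; unfold_values;
  rewrite ?e6 ?e5 ?e4 ?e3 ?e1 ?e2; field; nonzero.
Qed.

(** Recoupling: both families of values are linear images of the n + 1 numbers
    P m 0 (n - m), so each is a linear image of the other; the coefficients are
    the q-6j symbols of [sixj]. *)
Lemma left_of_right n j : (0 < n <= 3)%N -> (j <= n)%N ->
  sixj_den T Q n * left_value P n j =
  \sum_(l < n.+1) sixj_weight T Q n l * sixj T Q n l j * right_value P n l.
Proof.
by case: n => [|[|[|[|]]]] // _;
  [apply: left_of_right1|apply: left_of_right2|apply: left_of_right3].
Qed.

Lemma right_of_left n j : (0 < n <= 3)%N -> (j <= n)%N ->
  sixj_den T Q n * right_value P n j =
  T^+n * \sum_(l < n.+1) sixj_weight T Q n l * sixj T Q n l j * left_value P n l.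
Proof.
by case: n => [|[|[|[|]]]] // _;
  [apply: right_of_left1|apply: right_of_left2|apply: right_of_left3].
Qed.

(** If P vanishes for first index beyond n - i, then P (n - i) m (i - m) is a
    multiple of P (n - i) 0 i and [right_value P n i] factors completely:
    the map from the numbers P m 0 (n - m) to the right values is triangular. *)
Lemma right_value_leading n i : (0 < n <= 3)%N -> (i <= n)%N ->
  (forall a b c, (n - i < a)%N -> P a b c = 0) -> P (n - i)%N 0%N i = 1 ->
  (forall l, (l < i)%N -> right_value P n l = 0) /\ right_value P n i != 0.
Proof.
move=> /andP[n0 n3] lein Pz P1; split=> [l lti|].
  rewrite /right_value big1 ?mulr0 // => m _; rewrite Pz ?mulr0 //.
  by rewrite ltn_sub2l // (leq_trans lti).
have [[_ Tp _] [_ TpQ _ _] [_ TpQ2] _] := nondeg_factors nd.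
have [_ T2Q _ T2Q3 _] := nondeg_squares nd.
have nz (u v : F) : u = v -> v != 0 -> u != 0 by move=> ->.
have scale0 : right_scale n i != 0.
  move: n n0 n3 lein {Pz P1} => [|[|[|[|]]]] // _ _;
    case: i => [|[|[|[|]]]] // _; rewrite /right_scale /table /=;
    by rewrite ?oppr_eq0 ?mulf_neq0 ?expf_neq0 ?oner_eq0.
rewrite /right_value mulf_neq0 //.
set a := (n - i)%N in Pz P1.
have rec b c : (b <= 2)%N ->
    P a b.+1 c = - (T - Q^+c) / (Q^+c * (T - Q^+b)) * P a b c.+1.
  move=> b2; rewrite (coinvariance_solve b2 (HP a b c)) Pz // mulr0 add0r.
  by field; rewrite T0 T_Qexp // expf_neq0.
have r0 c : P a 1 c = _ := rec 0%N c isT.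
have r1 c : P a 2 c = _ := rec 1%N c isT.
have r2 c : P a 3 c = _ := rec 2%N c isT.
have : (i <= 3)%N by apply: leq_trans n3.
rewrite -/a; clear scale0; clearbody a.
case: i P1 {lein Pz} => [|[|[|[|]]]] //= P1 _;
  rewrite !(big_ord_recl, big_ord0) /= /bump /hw_coef /table /=
    !(addn0, add0n, subn0, subnn, subSS) /= ?r2 ?r1 ?r0 P1.
- by rewrite expr0 !mul1r addr0 oner_eq0.
- by apply: (nz _ (T + 1)) => //; field; nonzero.
- apply: (nz _ ((T + Q) * (T^+2 - Q) / (Q * (T - 1)))).
    by field; nonzero.
  by rewrite !mulf_neq0 ?invr_eq0 ?mulf_neq0.
- apply: (nz _ ((T + Q) * (T^+2 - Q^+3) * (T + Q^+2) / (Q^+3 * (T - 1)))).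
    by field; nonzero.
  by rewrite !mulf_neq0 ?invr_eq0 ?mulf_neq0 ?expf_neq0.
Qed.
End Recoupling.

(** The solution of the coinvariance equations on indices of sum n for which
    P m 0 (n - m) is 1 at m = e and 0 at the other m. *)
Fixpoint seed_value e b a c : F :=
  if b is b'.+1 then
    - (Q^+(b' + c) * (T - Q^+a) * seed_value e b' a.+1 c
       + T * (T - Q^+c) * seed_value e b' a c.+1) / (T * Q^+c * (T - Q^+b'))
  else (a == e)%:R.
Definition seed_profile n e a b c : F :=
  if (a + b + c == n)%N then seed_value e b a c else 0.

Lemma seed_profile_gt n e a b c : (e < a)%N -> seed_profile n e a b c = 0.
Proof.
rewrite /seed_profile; case: ifP => // _ {n}; elim: b a c => [|b IH] a c lt /=.
  by rewrite gtn_eqF.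
by rewrite !IH ?(leq_trans lt) // !mulr0 addr0 oppr0 mul0r.
Qed.

Lemma seed_profile_lead n e : (e <= n)%N -> seed_profile n e e 0 (n - e) = 1.
Proof. by move=> le; rewrite /seed_profile addn0 subnKC // eqxx /= eqxx. Qed.

Lemma seed_profile_coinvariance n e a b c : (n <= 3)%N ->
  coinvariance (seed_profile n e) a b c = 0.
Proof.
move=> n3; rewrite /coinvariance /seed_profile !addSn !addnS !addSn.
case: eqP => [abc|_]; last by rewrite !mulr0 !addr0.
have Tb : T - Q^+b != 0.
  by rewrite T_Qexp // -ltnS (leq_trans _ n3) // -abc ltnS -addnA addnCA leq_addr.
by rewrite /=; field; rewrite T0 Tb expf_neq0.
Qed.
End Coinvariants.

(** * From the Yang-Baxter equation to scalar equations *)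

(** The matrices X12, Y12, X23, Y23 stand for R_12(l), R_12(2l), R_23(l), R_23(2l)
    and [coinv] for the functionals preserved by them; [w] and [g] are the
    eigenvectors of the first and of the second pair. *)
Section YangBaxterComponents.
Variables (F : fieldType) (m n : nat) (X12 Y12 X23 Y23 : 'M[F]_m)
  (coinv : 'rV[F]_m -> Prop) (w g : nat -> 'cV[F]_m)
  (d D : nat -> F) (A : nat -> nat -> F) (L : nat -> F) (M s : F).
Hypotheses
  (coinvM : forall (psi : 'rV[F]_m) G, G \in [:: X12; Y12; X23; Y23] ->
     coinv psi -> coinv (psi *m G))
  (wX : forall k, (k <= n)%N -> X12 *m w k = d k *: w k)
  (wY : forall k, (k <= n)%N -> Y12 *m w k = D k *: w k)
  (gX : forall k, (k <= n)%N -> X23 *m g k = d k *: g k)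
  (gY : forall k, (k <= n)%N -> Y23 *m g k = D k *: g k)
  (M0 : M != 0) (s0 : s != 0) (L0 : forall k, (k <= n)%N -> L k != 0)
  (wg : forall psi j, coinv psi -> (j <= n)%N ->
     M *: (psi *m w j) = \sum_(l < n.+1) (L l * A l j) *: (psi *m g l))
  (gw : forall psi j, coinv psi -> (j <= n)%N ->
     M *: (psi *m g j) = s *: \sum_(l < n.+1) (L l * A l j) *: (psi *m w l))
  (tri : forall i, (i <= n)%N -> exists psi, [/\ coinv psi,
     forall l, (l < i)%N -> psi *m g l = 0 & psi *m g i != 0])
  (YB : X12 *m Y23 *m X12 = X23 *m Y12 *m X23).

(** The values on the vectors [g i] are independent by triangularity, so a linear
    relation that holds for all functionals is trivial. *)
Let separate (x : nat -> F) :
  (forall psi, coinv psi -> \sum_(i < n.+1) x i *: (psi *m g i) = 0) ->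
  forall i, (i <= n)%N -> x i = 0.
Proof.
move=> hx i; have [p hp] : exists p, (n - i <= p)%N by exists n; rewrite leq_subr.
elim: p i hp => [|p IH] i hp lein.
all: have [psi [cpsi lo hi]] := tri lein; have := hx _ cpsi;
  rewrite (bigD1 (Ordinal (lein : i < n.+1)%N)) //= big1 ?addr0.
1,3: by move=> /eqP; rewrite scaler_eq0 (negPf hi) orbF => /eqP.
all: move=> k ki; have kn := ltn_ord k.
all: have [/lo->|ik] := ltnP k i; first by rewrite scaler0.
all: have ltik : (i < k)%N by rewrite ltn_neqAle ik andbT eq_sym.
- by move: hp; rewrite leqn0 subn_eq0 leqNgt (leq_trans ltik).
rewrite IH ?scale0r //; apply: leq_trans (_ : (n - i).-1 <= p)%N.
  by rewrite -subnS leq_sub2l.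
by case: (n - i)%N hp.
Qed.

(** Evaluating both sides of the Yang-Baxter equation on [w j] and moving the
    functional from one factor to the next by alternate recouplings expresses both
    sides through the values on the [g i]; then the coefficients must agree. *)
Lemma yb_sum_eq0 i j : (i <= n)%N -> (j <= n)%N -> yb_sum n A L d d D i j = 0.
Proof.
move=> lein lejn.
have closed G : G \in [:: X12; Y12; X23; Y23] ->
    forall psi, coinv psi -> coinv (psi *m G).
  by move=> h psi; apply: coinvM.
have cX12 := closed X12; have cX23 := closed X23.
have cY12 := closed Y12; have cY23 := closed Y23.
rewrite !inE !eqxx ?orbT in cX12 cX23 cY12 cY23.
have wg' psi k : coinv psi -> (k <= n)%N ->
    psi *m w k = \sum_(l < n.+1) (M^-1 * (L l * A l k)) *: (psi *m g l).
  move=> h1 h2; apply: (scalerI M0); rewrite wg // scaler_sumr.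
  apply: eq_bigr => l _.
  by rewrite scalerA mulVKf.
have gw' psi k : coinv psi -> (k <= n)%N ->
    psi *m g k = \sum_(l < n.+1) (s * M^-1 * (L l * A l k)) *: (psi *m w l).
  move=> h1 h2; apply: (scalerI M0); rewrite gw // !scaler_sumr.
  apply: eq_bigr => l _.
  by rewrite !scalerA; congr (_ *: _); field.
pose c i := L i * s * M^-1 ^+ 3.
suff /(_ i lein) : forall i, (i <= n)%N -> c i * yb_sum n A L d d D i j = 0.
  move=> /eqP; apply: contraTeq => nz; rewrite !mulf_neq0 ?expf_neq0 ?invr_eq0 //.
  exact: L0.
apply: separate => psi cpsi.
have E1 : psi *m (X12 *m Y23 *m X12) *m w j =
    \sum_(i < n.+1) \sum_(k < n.+1) \sum_(l < n.+1)
      (d j * (M^-1 * (L l * A l j)) * D l * (s * M^-1 * (L k * A k l)) * d k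
       * (M^-1 * (L i * A i k))) *: (psi *m g i).
  rewrite !mulmxA -mulmxA wX // -scalemxAr wg'; [|by auto|by []].
  rewrite scaler_sumr.
  under eq_bigr => l _.
    rewrite -mulmxA gY -1?ltnS // -scalemxAr gw' -1?ltnS //; last by auto.
    rewrite !scaler_sumr.
    under eq_bigr => k _.
      rewrite -mulmxA wX -1?ltnS // -scalemxAr wg' -1?ltnS // !scaler_sumr.
      under eq_bigr => i' _ do rewrite !scalerA.
      over.
    over.
  rewrite exchange_big /=; under eq_bigr => k _ do rewrite exchange_big.
  rewrite exchange_big /=; apply: eq_bigr => i' _; apply: eq_bigr => k _.
  apply: eq_bigr => l _.
  by congr (_ *: _); rewrite !mulrA.
have E2 : psi *m (X23 *m Y12 *m X23) *m w j =
    \sum_(i < n.+1) \sum_(k < n.+1) \sum_(l < n.+1)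
      ((M^-1 * (L l * A l j)) * d l * (s * M^-1 * (L k * A k l)) * D k
       * (M^-1 * (L i * A i k)) * d i) *: (psi *m g i).
  rewrite !mulmxA wg'; [|by auto|by []].
  under eq_bigr => l _.
    rewrite -mulmxA gX -1?ltnS // -scalemxAr gw' -1?ltnS //; last by auto.
    rewrite !scaler_sumr.
    under eq_bigr => k _.
      rewrite -mulmxA wY -1?ltnS // -scalemxAr wg' -1?ltnS //; last by auto.
      rewrite !scaler_sumr.
      under eq_bigr => i' _ do rewrite -mulmxA gX -1?ltnS // -scalemxAr !scalerA.
      over.
    over.
  rewrite exchange_big /=; under eq_bigr => k _ do rewrite exchange_big.
  rewrite exchange_big /=; apply: eq_bigr => i' _; apply: eq_bigr => k _.
  apply: eq_bigr => l _.
  by congr (_ *: _); rewrite !mulrA.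
have := E1; rewrite YB E2 => /esym/eqP; rewrite -subr_eq0 -sumrB => /eqP E.
rewrite -[RHS]E; apply: eq_bigr => i' _.
rewrite /yb_sum mulr_sumr scaler_suml -sumrB; apply: eq_bigr => k _.
rewrite mulr_sumr scaler_suml -sumrB; apply: eq_bigr => l _.
by rewrite -scalerBl; congr (_ *: _); rewrite /c; ring.
Qed.
End YangBaxterComponents.

(** * Tensor products of column vectors *)

Section TensorVectors.
Variable F : comPzRingType.

Definition tensv m n (u : 'cV[F]_m) (v : 'cV[F]_n) : 'cV[F]_(m * n) :=
  \col_k (u (mxtens_unindex k).1 0 * v (mxtens_unindex k).2 0).

Lemma tensmx_tensv m n p q (A : 'M[F]_(m, n)) (B : 'M[F]_(p, q)) u v :
  tensmx A B *m tensv u v = tensv (A *m u) (B *m v).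
Proof.
apply/colP => i; rewrite !mxE mulr_sum; apply: eq_bigr => k _.
by rewrite !mxE mulrACA.
Qed.

Lemma tensvZl m n c (u : 'cV[F]_m) (v : 'cV[F]_n) :
  tensv (c *: u) v = c *: tensv u v.
Proof. by apply/colP => i; rewrite !mxE mulrA. Qed.

Lemma tensvZr m n c (u : 'cV[F]_m) (v : 'cV[F]_n) :
  tensv u (c *: v) = c *: tensv u v.
Proof. by apply/colP => i; rewrite !mxE mulrCA. Qed.

Lemma tensvZZ m n a b (u : 'cV[F]_m) (v : 'cV[F]_n) : tensv (a *: u) (b *: v) =
  (a * b) *: tensv u v.
Proof. by rewrite tensvZl tensvZr scalerA. Qed.

Lemma tensvDl m n (u u' : 'cV[F]_m) (v : 'cV[F]_n) :
  tensv (u + u') v = tensv u v + tensv u' v.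
Proof. by apply/colP => i; rewrite !mxE mulrDl. Qed.

Lemma tensvDr m n (u : 'cV[F]_m) (v v' : 'cV[F]_n) :
  tensv u (v + v') = tensv u v + tensv u v'.
Proof. by apply/colP => i; rewrite !mxE mulrDr. Qed.

Lemma tensv_comb m n a b c a' c' (u u' u2 : 'cV[F]_m) (v v2 : 'cV[F]_n) :
  tensv (a *: u + b *: u') (c *: v) + tensv (a' *: u2) (c' *: v2)
  = (a * c) *: tensv u v + (b * c) *: tensv u' v + (a' * c') *: tensv u2 v2.
Proof. by rewrite tensvDl !tensvZZ. Qed.

Lemma entry_comb n a b c (psi : 'rV[F]_n) (u v w : 'cV[F]_n) :
  (psi *m (a *: u + b *: v + c *: w)) 0 0 =
  a * (psi *m u) 0 0 + b * (psi *m v) 0 0 + c * (psi *m w) 0 0.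
Proof.
have addE (A B : 'M[F]_1) : (A + B) 0 0 = A 0 0 + B 0 0 by rewrite mxE.
have scaleE x (A : 'M[F]_1) : (x *: A) 0 0 = x * A 0 0 by rewrite mxE.
by rewrite !mulmxDr -!scalemxAr !addE !scaleE.
Qed.

Lemma entryZ n a (psi : 'rV[F]_n) (u : 'cV[F]_n) :
  (psi *m (a *: u)) 0 0 = a * (psi *m u) 0 0.
Proof. by rewrite -scalemxAr mxE. Qed.

Lemma tensv_suml m n I (r : seq I) (P : pred I) (u : I -> 'cV[F]_m) (v : 'cV[F]_n) :
  tensv (\sum_(i <- r | P i) u i) v = \sum_(i <- r | P i) tensv (u i) v.
Proof.
elim/big_rec2: _ => [|i x y _ <-]; last by rewrite tensvDl.
by apply/colP => k; rewrite !mxE mul0r.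
Qed.

Lemma tensv_sumr m n I (r : seq I) (P : pred I) (u : 'cV[F]_m) (v : I -> 'cV[F]_n) :
  tensv u (\sum_(i <- r | P i) v i) = \sum_(i <- r | P i) tensv u (v i).
Proof.
elim/big_rec2: _ => [|i x y _ <-]; last by rewrite tensvDr.
by apply/colP => k; rewrite !mxE mulr0.
Qed.

Lemma tensmxDl m n p q (A B : 'M[F]_(m, n)) (C : 'M[F]_(p, q)) :
  tensmx (A + B) C = tensmx A C + tensmx B C.
Proof. by apply/matrixP => i j; rewrite !mxE mulrDl. Qed.

Lemma tensmxDr m n p q (A : 'M[F]_(m, n)) (B C : 'M[F]_(p, q)) :
  tensmx A (B + C) = tensmx A B + tensmx A C.
Proof. by apply/matrixP => i j; rewrite !mxE mulrDr. Qed.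

(** Regrouping the index of a triple tensor product leaves its components alone;
    this is what makes the casts in [op23] harmless. *)
Lemma unindexA n (k : 'I_(n * n * n)) (e : (n * n * n = n * (n * n))%N) :
  let k' := mxtens_unindex (cast_ord e k) in
  [/\ k'.1 = (mxtens_unindex (mxtens_unindex k).1).1,
      (mxtens_unindex k'.2).1 = (mxtens_unindex (mxtens_unindex k).1).2
    & (mxtens_unindex k'.2).2 = (mxtens_unindex k).2].
Proof.
case: (mxtens_indexP k) => ab c; case: (mxtens_indexP ab) => a b.
have -> : cast_ord e (mxtens_index (mxtens_index (a, b), c))
   = mxtens_index (a, mxtens_index (b, c)).
  by apply: val_inj => /=; rewrite mulnDl -mulnA addnA.
by cbv zeta; rewrite !mxtens_indexK /= ?mxtens_indexK.
Qed.

Lemma tensmxA n (A B C : 'M[F]_n) :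
  castmx (mulnA _ _ _, mulnA _ _ _) (tensmx A (tensmx B C)) = tensmx (tensmx A B) C.
Proof.
apply/matrixP => i j; rewrite castmxE !mxE.
have [-> -> ->] := unindexA i (esym (mulnA n n n)).
by have [-> -> ->] := unindexA j (esym (mulnA n n n)); rewrite mulrA.
Qed.

(** The vector u (x) (v (x) w), read in the bracketing that [End3] uses. *)
Definition tensvr n (u : 'cV[F]_n) (z : 'cV[F]_(n * n)) : 'cV[F]_(n * n * n) :=
  castmx (mulnA _ _ _, erefl _) (tensv u z).

Lemma tensvrE n (u v w : 'cV[F]_n) : tensvr u (tensv v w) = tensv (tensv u v) w.
Proof.
apply/colP => i; rewrite castmxE !mxE.
by have [-> -> ->] := unindexA i (esym (mulnA n n n)); rewrite mulrA.
Qed.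

Lemma castmx_mulmx m m' (e : m = m') p (A : 'M[F]_m) (v : 'M[F]_(m, p)) :
  castmx (e, e) A *m castmx (e, erefl p) v = castmx (e, erefl p) (A *m v).
Proof. by case: _ / e; rewrite !castmx_id. Qed.

Lemma castmxM m m' (e : m = m') (A B : 'M[F]_m) :
  castmx (e, e) A *m castmx (e, e) B = castmx (e, e) (A *m B).
Proof. by case: _ / e; rewrite !castmx_id. Qed.

Lemma castmxD m m' (e : m = m') (A B : 'M[F]_m) :
  castmx (e, e) (A + B) = castmx (e, e) A + castmx (e, e) B.
Proof. by case: _ / e; rewrite !castmx_id. Qed.

Lemma tensvrZ n c (u : 'cV[F]_n) z : tensvr u (c *: z) = c *: tensvr u z.
Proof. by rewrite /tensvr tensvZr; apply/colP => i; rewrite !(castmxE, mxE). Qed.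

Lemma tensvr_sum n I (r : seq I) (P : pred I) (u : 'cV[F]_n)
    (v : I -> 'cV[F]_(n * n)) :
  tensvr u (\sum_(i <- r | P i) v i) = \sum_(i <- r | P i) tensvr u (v i).
Proof.
rewrite /tensvr tensv_sumr; apply/colP => k; rewrite castmxE !summxE.
by apply: eq_bigr => i _; rewrite castmxE.
Qed.
End TensorVectors.

(** * The total lowering operator on the tensor cube *)

Section TripleLowering.
Variables (R : realType) (N : nat).
Notation C := (Cplx R).
Implicit Types (h : C) (P : nat -> End2 R N) (A : End2 R N).

Lemma op12_tensv A u w : op12 A *m tensv u w = tensv (A *m u) w.
Proof. by rewrite tensmx_tensv mul1mx. Qed.

Lemma op23_tensvr A u z : op23 A *m tensvr u z = tensvr u (A *m z).
Proof. by rewrite /op23 /tensvr castmx_mulmx tensmx_tensv mul1mx. Qed.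

(** The iterated co-multiplication of S^-, with the first two factors grouped; it
    commutes with R_12 because of this grouping and with R_23 because of the other
    one ([Sm3E]). *)
Definition Sm3 h : End3 R N :=
  tensmx (DSm h N) (qSzV h N) + tensmx (tensmx (qSz h N) (qSz h N)) (Sm h N).

Lemma Sm3E h : Sm3 h = castmx (mulnA _ _ _, mulnA _ _ _)
  (tensmx (Sm h N) (tensmx (qSzV h N) (qSzV h N)) + tensmx (qSz h N) (DSm h N)).
Proof.
by rewrite /DSm tensmxDr !castmxD !tensmxA /Sm3 /DSm tensmxDl addrA.
Qed.

(** Commutation with the part of the quantum group that occurs in [Sm3]. *)
Definition equivariant h A : Prop :=
  [/\ A *m DSm h N = DSm h N *m A,
      A *m tensmx (qSz h N) (qSz h N) = tensmx (qSz h N) (qSz h N) *m A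
    & A *m tensmx (qSzV h N) (qSzV h N) = tensmx (qSzV h N) (qSzV h N) *m A].

Lemma op12_Sm3 h A : equivariant h A -> op12 A *m Sm3 h = Sm3 h *m op12 A.
Proof.
case=> hm hq hv; rewrite /Sm3 /op12 mulmxDr mulmxDl !tensmx_mul.
by rewrite !mul1mx !mulmx1 hm hq.
Qed.

Lemma op23_Sm3 h A : equivariant h A -> op23 A *m Sm3 h = Sm3 h *m op23 A.
Proof.
case=> hm hq hv; rewrite Sm3E /op23 !castmxM; congr castmx.
by rewrite mulmxDr mulmxDl !tensmx_mul !mul1mx !mulmx1 hm hv.
Qed.

End TripleLowering.

(** * The exponential and q-numbers *)

Section Exponential.
Variable R : realType.
Notation C := (Cplx R).
Implicit Types h x y : C.

Lemma cexpD x y : cexp (x + y) = cexp x * cexp y.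
Proof.
case: x y => [a b] [c d]; rewrite /cexp /= expRD cosD sinD.
by apply/eqP; rewrite eq_complex /=; apply/andP; split; apply/eqP; ring.
Qed.

Lemma cexp0 : cexp (0 : C) = 1.
Proof. by rewrite /cexp /= expR0 cos0 sin0 mul1r mulr0. Qed.

Lemma cexp_neq0 x : cexp x != 0.
Proof.
apply/eqP => e; have := cexp0; rewrite -(subrr x) cexpD e mul0r => /esym/eqP.
by rewrite oner_eq0.
Qed.

Lemma cexpN x : cexp (- x) = (cexp x)^-1.
Proof.
by apply: (mulfI (cexp_neq0 x)); rewrite -cexpD subrr cexp0 divff ?cexp_neq0.
Qed.

Lemma qpowD h x y : qpow h (x + y) = qpow h x * qpow h y.
Proof. by rewrite /qpow mulrDl cexpD. Qed.

Lemma qpow0 h : qpow h 0 = 1.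
Proof. by rewrite /qpow mul0r cexp0. Qed.

Lemma qpowN h x : qpow h (- x) = (qpow h x)^-1.
Proof. by rewrite /qpow mulNr cexpN. Qed.

Lemma qpow_neq0 h x : qpow h x != 0.
Proof. exact: cexp_neq0. Qed.

Lemma qpowX h n : qpow h n%:R = cexp h ^+ n.
Proof.
elim: n => [|n IH]; first by rewrite qpow0 expr0.
by rewrite -natr1 qpowD IH exprSr /qpow mul1r.
Qed.

Lemma qnumE h a : cexp h != 1 ->
  qnum h a%:R = (cexp h ^+ a - cexp h ^- a) / (cexp h - (cexp h)^-1).
Proof. by move=> /negPf q1; rewrite /qnum q1 qpowN qpowX. Qed.

Lemma qnum0 h : qnum h 0 = 0.
Proof. by rewrite /qnum; case: eqP => // _; rewrite oppr0 subrr mul0r. Qed.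

Section SmallIntegers.
Variable h : C.

(** This holds both for generic q and at q = 1, the two cases of interest. *)
Hypothesis hq : cexp h ^+ 2 = 1 -> cexp h = 1.
Let q := cexp h.

Let qnum_val a (v : C) : (q = 1 -> v = a%:R) ->
  (q - q^-1 != 0 -> q ^+ a - q ^- a = v * (q - q^-1)) -> qnum h a%:R = v.
Proof.
rewrite /q; case: (eqVneq (cexp h) 1) => [e|q1] h1 h2.
  by rewrite /qnum e eqxx h1.
have q0 := cexp_neq0 h.
have qq : cexp h - (cexp h)^-1 != 0.
  apply: contra q1 => /eqP e; apply/eqP/hq/eqP; rewrite -subr_eq0.
  rewrite -(mulrI_eq0 _ (mulfI (invr_neq0 q0))) mulrBr mulKf // mulr1.
  by rewrite e.
by rewrite qnumE // h2 // mulfK.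
Qed.

Lemma qnum1 : qnum h 1%:R = 1.
Proof. by apply: qnum_val => //; rewrite mul1r expr1. Qed.

Lemma qnum2 : qnum h 2%:R = q + q^-1.
Proof.
apply: qnum_val => [->|_]; first by rewrite invr1.
by field; rewrite cexp_neq0.
Qed.

Lemma qnum3 : qnum h 3%:R = q^+2 + 1 + q^-2.
Proof.
apply: qnum_val => [->|_]; first by rewrite expr1n invr1 -addrA.
by field; rewrite cexp_neq0.
Qed.
End SmallIntegers.

Lemma generic_qnum_neq0 h n : generic (cexp h) -> (0 < n)%N -> qnum h n%:R != 0.
Proof.
move=> [q0 hq] n0; have q1 : cexp h != 1 := hq 1%N isT.
have nz k : (0 < k)%N -> cexp h ^+ k - cexp h ^- k != 0.
  move=> k0; apply/eqP => e; have := hq (k + k)%N.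
  rewrite addn_gt0 k0 => /(_ isT)/eqP; apply.
  have qk : cexp h ^+ k != 0 by rewrite expf_neq0.
  apply: (mulIf (invr_neq0 qk)); rewrite exprD mulfK // mul1r.
  by apply/eqP; rewrite -subr_eq0 e.
rewrite qnumE // mulf_neq0 ?invr_eq0 ?nz //.
by rewrite -[X in X - _]expr1 -[X in _ - X^-1]expr1 nz.
Qed.

Lemma qnum_log0 n : qnum (0 : C) n%:R = n%:R.
Proof. by rewrite /qnum cexp0 eqxx. Qed.

End Exponential.

Lemma generic_expr_neq (R : realType) (q : Cplx R) a b :
  generic q -> a != b -> q ^+ a - q ^+ b != 0.
Proof.
move=> [q0 hq]; wlog lt : a b / (a < b)%N => [hw ab|_].
  case: (ltngtP a b) => [lt|lt|e]; first exact: hw.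
    by rewrite -opprB oppr_eq0 hw // ltn_eqF.
  by move: ab; rewrite e eqxx.
have := hq (b - a)%N; rewrite subn_gt0 lt => /(_ isT).
apply: contraNneq => e; apply/eqP/(mulfI (expf_neq0 a q0)).
by rewrite mulr1 -exprD subnKC 1?ltnW //; apply/esym/eqP; rewrite -subr_eq0 e.
Qed.

Lemma generic_nondeg (R : realType) (q : Cplx R) N : (3 <= N)%N -> generic q ->
  nondeg ((q ^+ N) ^+ 2) (q ^+ 2).
Proof.
move=> N3 gen; have q0 := gen.1; have h a b := @generic_expr_neq _ _ a b gen.
have h0 a : (0 < a)%N -> q ^+ a - 1 != 0.
  by move=> a0; rewrite -(expr0 q) h // -lt0n.
rewrite /nondeg /= -!exprM -exprD !expf_neq0 //=.
repeat (apply/andP; split).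
all: try by (apply: h0; lia).
all: try by (apply: h; lia).
all: by rewrite // -[q]expr1 -?exprM h //; lia.
Qed.

(** * Projectors and highest weight vectors *)

Section Projectors.
Variables (R : realType) (N : nat).
Notation C := (Cplx R).
Implicit Types (h : C) (P : nat -> End2 R N) (A : End2 R N).

Lemma diag_commute n (A : 'M[C]_n) (d e : 'rV[C]_n) :
  A *m diag_mx d = diag_mx d *m A ->
  (forall i j, d 0 i = d 0 j -> e 0 i = e 0 j) ->
  A *m diag_mx e = diag_mx e *m A.
Proof.
move=> /matrixP Ad de; apply/matrixP => i j; have := Ad i j.
rewrite !mul_mx_diag !mul_diag_mx !mxE mulrC => /eqP.
have [->|A0] := eqVneq (A i j) 0; first by rewrite !(mulr0, mul0r).
by move=> /eqP/(mulIf A0)/de ->; rewrite mulrC.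
Qed.

Notation pair_weight k :=
  (weight R (mxtens_unindex k).1 + weight R (mxtens_unindex k).2).

Lemma DSzE : DSz R N = diag_mx (\row_k pair_weight k).
Proof.
apply/matrixP => i j; rewrite !mxE -(can_eq (@mxtens_unindexK _ _)).
case: (mxtens_unindex i) (mxtens_unindex j) => [a b] [c d] /=.
rewrite xpair_eqE.
by case: eqVneq => [->|_]; case: eqVneq => [->|_] /=;
  rewrite ?(mulr1n, mulr0n, mulr1, mul1r, mulr0, mul0r, addr0).
Qed.

Lemma tens_qSzE h :
  tensmx (qSz h N) (qSz h N) = diag_mx (\row_k qpow h (pair_weight k)).
Proof.
apply/matrixP => i j; rewrite !mxE -(can_eq (@mxtens_unindexK _ _)) qpowD.
case: (mxtens_unindex i) (mxtens_unindex j) => [a b] [c d] /=.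
rewrite xpair_eqE.
by case: eqVneq => [->|_]; case: eqVneq => [->|_] /=;
  rewrite ?(mulr1n, mulr0n, mulr0, mul0r).
Qed.

Lemma tens_qSzVE h :
  tensmx (qSzV h N) (qSzV h N) = diag_mx (\row_k qpow h (- pair_weight k)).
Proof.
apply/matrixP => i j; rewrite !mxE -(can_eq (@mxtens_unindexK _ _)).
case: (mxtens_unindex i) (mxtens_unindex j) => [a b] [c d] /=.
rewrite xpair_eqE.
case: eqVneq => [->|_]; case: eqVneq => [->|_] /=.
all: rewrite ?(mulr1n, mulr0n, mulr0, mul0r).
by rewrite -qpowD -opprD.
all: by [].
Qed.

(** Commuting with S^z means preserving weights, hence commuting with every function
    of the weight. *)
Lemma commute_DSz h A :
  A *m DSz R N = DSz R N *m A -> A *m DSm h N = DSm h N *m A ->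
  equivariant h A.
Proof.
rewrite DSzE => hz hm; split=> //.
  by rewrite tens_qSzE; apply: diag_commute hz _ => i j; rewrite !mxE => ->.
by rewrite tens_qSzVE; apply: diag_commute hz _ => i j; rewrite !mxE => ->.
Qed.

(** Insert the decomposition of the identity on the right of K_i G: the summand
    K_i G J_j K_j equals K_i J_j g_j K_j, so only j = i survives. *)
Lemma coordinate_intertwines (J : forall j, 'M[C]_(N.+1 * N.+1, (j.*2).+1))
    (K : forall j, 'M[C]_((j.*2).+1, N.+1 * N.+1))
    (G : End2 R N) (g : forall j : nat, 'M[C]_(j.*2.+1)) i :
  (forall j, (j <= N)%N -> K j *m J j = 1%:M) ->
  (forall i j, (i <= N)%N -> (j <= N)%N -> i != j -> K i *m J j = 0) ->
  \sum_(j < N.+1) J j *m K j = 1%:M ->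
  (forall j, (j <= N)%N -> G *m J j = J j *m g j) ->
  (i <= N)%N -> K i *m G = g i *m K i.
Proof.
move=> KJ KJ0 JK hG lei; rewrite -[LHS]mulmx1 -JK mulmx_sumr.
rewrite (bigD1 (Ordinal (lei : i < N.+1)%N)) //= big1 ?addr0 => [|k ki].
  by rewrite mulmxA -(mulmxA (K i)) hG // mulmxA KJ // mul1mx.
have kN : (k <= N)%N by rewrite -ltnS.
by rewrite mulmxA -(mulmxA (K i)) hG // mulmxA KJ0 ?mul0mx // eq_sym.
Qed.

Section Spectral.
Variables (h : C) (P : nat -> End2 R N).
Hypothesis hP : spin_projectors h P.

Lemma projector_equivariant j : (j <= N)%N -> equivariant h (P j).
Proof.
case: hP => J [K [hJ KJ KJ0 JK PE]] lej; have [Jz _ Jm] := hJ j lej.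
have Kz : K j *m DSz R N = Sz R j.*2 *m K j.
  by apply: (coordinate_intertwines (g := fun j => Sz R j.*2) KJ) => // i /hJ[].
have Km : K j *m DSm h N = Sm h j.*2 *m K j.
  by apply: (coordinate_intertwines (g := fun j => Sm h j.*2) KJ) => // i /hJ[].
by rewrite PE //; apply: commute_DSz; rewrite -mulmxA ?Kz ?Km !mulmxA ?Jz ?Jm.
Qed.

Lemma Rop_equivariant (r : nat -> C -> C) l : equivariant h (Rop P r l).
Proof.
have hj j : (j < N.+1)%N -> equivariant h (P j).
  by move=> ?; apply: projector_equivariant.
by split; rewrite /Rop mulmx_suml mulmx_sumr; apply: eq_bigr => j _;
  rewrite -scalemxAl -scalemxAr; congr (_ *: _); case: (hj j (ltn_ord j)).
Qed.

Hypothesis hq : forall n, (0 < n)%N -> qnum h n%:R != 0.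

(** In V_i the raising operator kills only the multiples of the top vector, whose
    weight is i; hence a highest weight vector of weight N - k has no coordinate
    in V_i for i other than N - k. *)
Lemma projector_hw_vec (v : 'cV[C]_(N.+1 * N.+1)) k j :
  (k <= N)%N -> (j <= N)%N ->
  DSp h N *m v = 0 -> DSz R N *m v = (N%:R - k%:R) *: v ->
  P j *m v = (j == N - k)%N%:R *: v.
Proof.
case: hP => J [K [hJ KJ KJ0 JK PE]] lek lej vp vz.
have Kv i : (i <= N)%N -> i != (N - k)%N -> K i *m v = 0.
  move=> lei ik.
  have Kz : K i *m DSz R N = Sz R i.*2 *m K i.
    by apply: (coordinate_intertwines (g := fun j => Sz R j.*2) KJ) => // a /hJ[].
  have Kp : K i *m DSp h N = Sp h i.*2 *m K i.
    by apply: (coordinate_intertwines (g := fun j => Sp h j.*2) KJ) => // a /hJ[].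
  have uz : Sz R i.*2 *m (K i *m v) = (N%:R - k%:R) *: (K i *m v).
    by rewrite mulmxA -Kz -mulmxA vz scalemxAr.
  have up : Sp h i.*2 *m (K i *m v) = 0 by rewrite mulmxA -Kp -mulmxA vp mulmx0.
  move: (K i *m v) uz up => u uz up; apply/colP => a; rewrite !mxE.
  have [lta|gea] := ltnP a i.*2.
    have := congr1 (fun x : 'cV_ _ => x (inord a.+1) 0) up; rewrite !mxE.
    rewrite (bigD1 a) //= big1 => [|b ba]; last first.
      by rewrite !mxE inordK ?ltnS // eqSS eq_sym val_eqE (negPf ba) mul0r.
    rewrite !mxE inordK ?ltnS // eqxx addr0 => /eqP; rewrite mulf_eq0.
    by rewrite (negPf (hq _)) ?subn_gt0 // => /eqP.
  have := congr1 (fun x : 'cV_ _ => x a 0) uz; rewrite /Sz mul_diag_mx !mxE.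
  have -> : weight R a = i%:R.
    have -> : a = ord_max.
      by apply: val_inj => /=; apply/eqP; rewrite eqn_leq gea andbT -ltnS.
    have n2 : (2 : C) != 0 by rewrite pnatr_eq0.
    by rewrite /weight /= -addnn natrD; field.
  rewrite -natrB // => /eqP; rewrite -subr_eq0 -mulrBl mulf_eq0 subr_eq0.
  by rewrite eqr_nat (negPf ik) => /eqP.
have v1 : v = J (N - k)%N *m (K (N - k)%N *m v).
  have lt : (N - k < N.+1)%N by rewrite ltnS leq_subr.
  rewrite -{1}[v]mul1mx -JK mulmx_suml (bigD1 (Ordinal lt)) //=.
  rewrite big1 ?addr0 ?mulmxA // => i ik.
  by rewrite -mulmxA Kv ?mulmx0 // -ltnS.
rewrite PE // -mulmxA; case: eqP => [->|/eqP jk]; first by rewrite -v1 scale1r.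
by rewrite Kv // mulmx0 scale0r.
Qed.

Lemma Rop_hw_vec (r : nat -> C -> C) l (v : 'cV[C]_(N.+1 * N.+1)) k :
  (k <= N)%N ->
  DSp h N *m v = 0 -> DSz R N *m v = (N%:R - k%:R) *: v ->
  Rop P r l *m v = r (N - k)%N l *: v.
Proof.
move=> lek vp vz; have lt : (N - k < N.+1)%N by rewrite ltnS leq_subr.
rewrite /Rop mulmx_suml (bigD1 (Ordinal lt)) //= big1 => [|i ik];
  rewrite -scalemxAl (projector_hw_vec lek _ vp vz) -1?ltnS //.
  by rewrite eqxx scale1r addr0.
by rewrite (negPf (_ : i != (N - k)%N :> nat)) ?scale0r ?scaler0.
Qed.
End Spectral.
End Projectors.

(** * Highest weight vectors of the tensor square *)

Section Basis.
Variables (R : realType) (N : nat) (h : Cplx R).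
Notation C := (Cplx R).
Let q := cexp h.
Let kap := qpow h (N%:R / 2).

(** The basis vector a steps below the top one, and 0 once a exceeds N, so that
    the lowering formula below needs no boundary case. *)
Definition bvec a : 'cV[C]_N.+1 := \col_i (i + a == N)%N%:R.

Lemma bvec_big a : (N < a)%N -> bvec a = 0.
Proof. by move=> lt; apply/colP => i; rewrite !mxE gtn_eqF // ltn_addl. Qed.

Lemma bvec_delta a : (a <= N)%N -> bvec a = delta_mx (inord (N - a)) 0.
Proof.
move=> le; apply/matrixP => i j; rewrite !mxE ord1 eqxx andbT -val_eqE /=.
rewrite inordK ?ltnS ?leq_subr //.
by rewrite -[(_ == N - a)%N](eqn_add2r a) subnK.
Qed.

Lemma mul_bvec p (A : 'M[C]_(p, N.+1)) a i : (a <= N)%N ->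
  (A *m bvec a) i 0 = A i (inord (N - a)).
Proof. by move=> le; rewrite bvec_delta // -colE !mxE. Qed.

Lemma Sp_bvec a : (a <= N)%N -> Sp h N *m bvec a = qnum h a%:R *: bvec a.-1.
Proof.
move=> le; apply/colP => i; rewrite mul_bvec // !mxE inordK ?ltnS ?leq_subr //.
case: a le => [|a] le; first by rewrite subn0 ltn_eqF //= mulr0n qnum0 mul0r.
rewrite -subSn // subSS -(eqn_add2r a) subnK 1?ltnW // subKn //.
by case: eqP => _; rewrite ?mulr1 ?mulr0.
Qed.

Lemma Sm_bvec a : Sm h N *m bvec a = qnum h (N - a)%:R *: bvec a.+1.
Proof.
have [lt|le] := ltnP N a; first by rewrite !bvec_big ?mulmx0 ?scaler0 // ltnW.
apply/colP => i; rewrite mul_bvec // !mxE inordK ?ltnS ?leq_subr //.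
rewrite -(eqn_add2r a) subnK // addSnnS.
by case: eqP => _; rewrite ?mulr1 ?mulr0.
Qed.

Lemma weight_inord a : (a <= N)%N ->
  weight R (inord (N - a) : 'I_N.+1) = N%:R / 2 - a%:R.
Proof.
move=> le; rewrite /weight inordK ?ltnS ?leq_subr // natrB //; set x : C := N%:R.
have n2 : (2 : C) != 0 by rewrite pnatr_eq0.
by field.
Qed.

Lemma diag_bvec (d : 'I_N.+1 -> C) (c : C) a :
  ((a <= N)%N -> d (inord (N - a)) = c) ->
  diag_mx (\row_i d i) *m bvec a = c *: bvec a.
Proof.
have [lt _|le /(_ isT) <-] := ltnP N a; first by rewrite !bvec_big ?mulmx0 ?scaler0.
apply/colP => i; rewrite mul_diag_mx !mxE.
case: eqP => [e|_]; last by rewrite !mulr0.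
congr (d _ * _); apply: val_inj; rewrite /= inordK ?ltnS ?leq_subr //.
by apply/esym/eqP; rewrite -(eqn_add2r a) subnK // e.
Qed.

Lemma Sz_bvec a : Sz R N *m bvec a = (N%:R / 2 - a%:R) *: bvec a.
Proof. by apply: diag_bvec => le; rewrite weight_inord. Qed.

Lemma qSz_bvec a : qSz h N *m bvec a = (kap / q ^+ a) *: bvec a.
Proof. by apply: diag_bvec => le; rewrite weight_inord // qpowD qpowN qpowX. Qed.

Lemma qSzV_bvec a : qSzV h N *m bvec a = (kap^-1 * q ^+ a) *: bvec a.
Proof.
apply: diag_bvec => le.
by rewrite weight_inord // qpowN qpowD qpowN qpowX invfM invrK.
Qed.

Definition bvec2 a b := tensv (bvec a) (bvec b).

Lemma DSz_bvec2 a b : DSz R N *m bvec2 a b = (N%:R - (a + b)%:R) *: bvec2 a b.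
Proof.
rewrite /DSz mulmxDl !tensmx_tensv !mul1mx !Sz_bvec tensvZl tensvZr -scalerDl natrD.
have n2 : (2 : C) != 0 by rewrite pnatr_eq0.
by congr (_ *: _); field.
Qed.

Lemma DSp_bvec2 a b : (a <= N)%N -> (b <= N)%N -> DSp h N *m bvec2 a b =
  (qnum h a%:R * (kap^-1 * q ^+ b)) *: bvec2 a.-1 b
  + (kap / q ^+ a * qnum h b%:R) *: bvec2 a b.-1.
Proof.
move=> la lb; rewrite /DSp mulmxDl !tensmx_tensv qSz_bvec qSzV_bvec !Sp_bvec //.
by rewrite !(tensvZl, tensvZr) !scalerA [X in X *: _]mulrC.
Qed.

(** The vector v_k; [kap ^+ 2] is q^N. *)
Definition hw_vec k : 'cV[C]_(N.+1 * N.+1) :=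
  \sum_(m < k.+1) (kap ^+ 2 ^+ m * hw_coef (q ^+ 2) k m) *: bvec2 m (k - m).

Lemma DSz_hw_vec k : DSz R N *m hw_vec k = (N%:R - k%:R) *: hw_vec k.
Proof.
rewrite mulmx_sumr scaler_sumr; apply: eq_bigr => m _.
by rewrite -scalemxAr DSz_bvec2 subnKC -1?ltnS // !scalerA mulrC.
Qed.

Lemma DSp_hw_vec k : (q ^+ 2 = 1 -> q = 1) -> (k <= 3)%N -> (k <= N)%N ->
  DSp h N *m hw_vec k = 0.
Proof.
move=> hq k3 kN; rewrite /hw_vec mulmx_sumr.
have k0 : kap != 0 := qpow_neq0 _ _.
have q0 : q != 0 := cexp_neq0 _.
under eq_bigr => m _.
  have mk : (m <= k)%N by rewrite -ltnS.
  rewrite -scalemxAr DSp_bvec2 ?(leq_trans _ kN) ?leq_subr //.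
  over.
case: k k3 kN => [|[|[|[|]]]] // _ _;
  rewrite !(big_ord_recl, big_ord0) /= /bump /=
     !(addn0, add0n, subn0, subnn, subSS) /=
     /hw_coef /table /= ?mulr0n ?qnum0 ?qnum1 ?qnum2 ?qnum3 // -/q.
- by rewrite !(mul0r, mulr0, scale0r, addr0, scaler0).
- by move: (bvec2 _ _) => u; apply/colP => i; rewrite !mxE; field; rewrite k0 q0.
- move: (bvec2 0 0) (bvec2 0 1) (bvec2 1 0) (bvec2 0 2) (bvec2 2 0).
  move=> u1 u2 u3 u4 u5.
  by apply/colP => i; rewrite !mxE; field; rewrite k0 q0.
- move: (bvec2 0 2) (bvec2 1 1) (bvec2 2 0) (bvec2 0 3) (bvec2 3 0).
  move=> u1 u2 u3 u4 u5.
  by apply/colP => i; rewrite !mxE; field; rewrite k0 q0.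
Qed.
End Basis.

(** * Functionals on the tensor cube *)

Section TripleFunctionals.
Variables (R : realType) (N : nat) (h : Cplx R).
Notation C := (Cplx R).
Let q := cexp h.
Let kap := qpow h (N%:R / 2).
Let t := kap ^+ 2.
Let T := t ^+ 2.
Let Q := q ^+ 2.
Hypothesis gen : generic q.
Notation e := (@bvec R N).
Implicit Type psi : 'rV[C]_(N.+1 * N.+1 * N.+1).

Let k0 : kap != 0. Proof. exact: qpow_neq0. Qed.
Let q0 : q != 0. Proof. exact: cexp_neq0. Qed.
Let t0 : t != 0. Proof. by rewrite expf_neq0. Qed.
Let T0 : T != 0. Proof. by rewrite expf_neq0. Qed.
Let Q0 : Q != 0. Proof. by rewrite expf_neq0. Qed.
Let qq : q ^+ 2 - 1 != 0. Proof. by rewrite subr_eq0; apply: gen.2. Qed.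

Lemma qpow_half_expr : t = q ^+ N.
Proof.
rewrite -qpowX /t expr2 -qpowD; congr qpow.
have n2 : (2 : C) != 0 by rewrite pnatr_eq0.
by field.
Qed.

Definition bvec3 a b c := tensv (bvec2 R N a b) (e c).
Definition coord3 psi a b c := (psi *m bvec3 a b c) 0 0.

Lemma bvec3_big a b c : [|| N < a, N < b | N < c]%N -> bvec3 a b c = 0.
Proof.
have z1 m n (v : 'cV[C]_n) : tensv (0 : 'cV[C]_m) v = 0.
  by apply/colP => k; rewrite !mxE mul0r.
have z2 m n (v : 'cV[C]_n) : tensv v (0 : 'cV[C]_m) = 0.
  by apply/colP => k; rewrite !mxE mulr0.
by rewrite /bvec3 /bvec2 => /or3P[] /bvec_big ->; rewrite ?z1 ?z2 ?z1.
Qed.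

Lemma coord3_entry psi a b c : (a <= N)%N -> (b <= N)%N -> (c <= N)%N ->
  coord3 psi a b c =
  psi 0 (mxtens_index (mxtens_index (inord (N - a), inord (N - b)),
                       inord (N - c))).
Proof.
move=> la lb lc; rewrite /coord3 mxE; set k' := mxtens_index _.
have E a' b' c' : bvec3 a b c (mxtens_index (mxtens_index (a', b'), c')) 0 =
    (a' + a == N)%N%:R * (b' + b == N)%N%:R * (c' + c == N)%N%:R.
  rewrite /bvec3 /bvec2 mxE mxtens_indexK [tensv _ _ _ _]mxE; cbn [fst snd].
  by rewrite mxtens_indexK !mxE.
rewrite (bigD1 k') //= big1 => [|k].
  by rewrite E !inordK ?ltnS ?leq_subr // !subnK // !eqxx !mulr1 addr0.
case: (mxtens_indexP k) => ab c'; case: (mxtens_indexP ab) => a' b' ne; rewrite E.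
case: eqP => [ea|_]; last by rewrite !mul0r mulr0.
case: eqP => [eb|_]; last by rewrite mulr0 mul0r mulr0.
case: eqP => [ec|_]; last by rewrite !mulr0.
have shift x (i : 'I_N.+1) : (x <= N)%N -> (i + x)%N = N -> i = inord (N - x).
  move=> lx ix; apply: val_inj; rewrite /= inordK ?ltnS ?leq_subr //.
  by apply/eqP; rewrite -(eqn_add2r x) subnK // ix.
case/negP: ne; apply/eqP; rewrite /k'; congr mxtens_index; congr pair; last first.
  by apply: shift.
by congr mxtens_index; congr pair; apply: shift.
Qed.

Lemma coord3_eq0 psi :
  (forall a b c, (a <= N)%N -> (b <= N)%N -> (c <= N)%N ->
     coord3 psi a b c = 0) ->
  psi = 0.
Proof.
move=> h0; apply/rowP => k; rewrite [RHS]mxE.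
case: (mxtens_indexP k) => ab c; case: (mxtens_indexP ab) => a b.
have := h0 _ _ _ (leq_subr a N) (leq_subr b N) (leq_subr c N).
by rewrite coord3_entry ?leq_subr // !subKn -1?ltnS // !inord_val.
Qed.

(** Dividing by the power of [t] = q^N makes the coinvariance equations polynomial
    in T = q^(2N) and Q = q^2. *)
Definition reduced psi a b c : C := coord3 psi a b c / t ^+ b.

Lemma DSm_bvec2 a b : DSm h N *m bvec2 R N a b =
  (qnum h (N - a)%:R * (kap^-1 * q ^+ b)) *: bvec2 R N a.+1 b
  + (kap / q ^+ a * qnum h (N - b)%:R) *: bvec2 R N a b.+1.
Proof.
rewrite /DSm mulmxDl !tensmx_tensv (qSz_bvec _ h) (qSzV_bvec _ h).
by rewrite !(Sm_bvec _ h) 2!tensvZZ.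
Qed.

Lemma qSz_bvec2 a b : tensmx (qSz h N) (qSz h N) *m bvec2 R N a b =
  (kap / q ^+ a * (kap / q ^+ b)) *: bvec2 R N a b.
Proof. by rewrite tensmx_tensv !(qSz_bvec _ h) tensvZZ. Qed.

Lemma Sm3_bvec3 a b c : Sm3 N h *m bvec3 a b c =
  (qnum h (N - a)%:R * (kap^-1 * q ^+ b) * (kap^-1 * q ^+ c)) *: bvec3 a.+1 b c
  + (kap / q ^+ a * qnum h (N - b)%:R * (kap^-1 * q ^+ c)) *: bvec3 a b.+1 c
  + (kap / q ^+ a * (kap / q ^+ b) * qnum h (N - c)%:R) *: bvec3 a b c.+1.
Proof.
rewrite /Sm3 mulmxDl (tensmx_tensv (DSm h N)) DSm_bvec2.
rewrite (tensmx_tensv (tensmx _ _)) qSz_bvec2 (qSzV_bvec _ h) (Sm_bvec _ h).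
exact: tensv_comb.
Qed.

Lemma coord3_Sm3 psi a b c : coord3 (psi *m Sm3 N h) a b c =
  (qnum h (N - a)%:R * (kap^-1 * q ^+ b) * (kap^-1 * q ^+ c)) * coord3 psi a.+1 b c
  + (kap / q ^+ a * qnum h (N - b)%:R * (kap^-1 * q ^+ c)) * coord3 psi a b.+1 c
  + (kap / q ^+ a * (kap / q ^+ b) * qnum h (N - c)%:R) * coord3 psi a b c.+1.
Proof. by rewrite /coord3 -mulmxA Sm3_bvec3 entry_comb. Qed.

Lemma coord3_Sm3_coinvariance psi a b c :
  (a <= N)%N -> (b <= N)%N -> (c <= N)%N ->
  coord3 (psi *m Sm3 N h) a b c =
  t ^+ b / (T * (q - q^-1) * q ^+ (a + b + c))
  * coinvariance T Q (reduced psi) a b c.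
Proof.
move=> la lb lc.
have q1 : q != 1 := gen.2 1%N isT.
have qn k : (k <= N)%N ->
    qnum h (N - k)%:R = (t / q ^+ k - q ^+ k / t) / (q - q^-1).
  by move=> le; rewrite qnumE // -/q exprB ?unitfE // -qpow_half_expr invf_div.
have rv a' b' c' : coord3 psi a' b' c' = reduced psi a' b' c' * t ^+ b'.
  by rewrite /reduced divfK // expf_neq0.
rewrite coord3_Sm3 3!rv 3?qn // /coinvariance.
have Qx k : Q ^+ k = q ^+ k * q ^+ k by rewrite /Q -exprM mulnC exprM expr2.
rewrite !(exprD q) !Qx !(exprD q) exprS /Q /T.
have qa := expf_neq0 a q0; have qb := expf_neq0 b q0; have qc := expf_neq0 c q0.
have tb := expf_neq0 b t0.
have qq' : q * q - 1 != 0 by rewrite -expr2.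
have k2 : kap * kap = t by rewrite /t expr2.
have ck (u v w : C) : u * (kap^-1 * v) * (kap^-1 * w) = u * v * w / t.
  by rewrite -k2; field.
have ck' (u v w : C) : kap / u * v * (kap^-1 * w) = v * w / u.
  have [->|u0] := eqVneq u 0; first by rewrite !invr0 !(mulr0, mul0r).
  by field; rewrite k0 u0.
rewrite ck ck'.
have ck3 (u v w : C) : kap / u * (kap / v) * w = t * w / (u * v).
  by rewrite mulrACA k2 -invfM mulrAC.
rewrite ck3.
move: (reduced psi) qa qb qc tb; move: (q ^+ a) (q ^+ b) (q ^+ c) (t ^+ b).
move: t t0 q q0 qq'; clear => t t0 q q0 qq qa qb qc tb f qa0 qb0 qc0 tb0.
by field; rewrite q0 qc0 qb0 qa0 qq t0.
Qed.

(** The power of [t] compensates the one in [reduced], so that the values of a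
    functional on these vectors are polynomial in T and Q. *)
Definition left_vec n k :=
  (left_scale T Q n k / t ^+ k) *: tensv (hw_vec N h k) (e (n - k)).
Definition right_vec n l :=
  right_scale T Q n l *: tensvr (e (n - l)) (hw_vec N h l).

Lemma left_vecE psi n k :
  (psi *m left_vec n k) 0 0 = left_value T Q (reduced psi) n k.
Proof.
rewrite /left_vec /hw_vec tensv_suml scaler_sumr mulmx_sumr summxE.
rewrite /left_value mulr_sumr.
apply: eq_bigr => m _.
rewrite tensvZl scalerA entryZ -/(bvec3 _ _ _) -/(coord3 _ _ _ _).
rewrite /reduced -/t -/q -/Q.
have mk : (m <= k)%N by rewrite -ltnS.
have tm := expf_neq0 (m : nat) t0; have tk := expf_neq0 (k - m) t0.
have -> : t ^+ k = t ^+ m * t ^+ (k - m) by rewrite -exprD subnKC.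
move: (coord3 _ _ _ _) (left_scale _ _ _ _) (hw_coef _ _ _) => v s c.
by field; rewrite tm tk.
Qed.

Lemma right_vecE psi n l :
  (psi *m right_vec n l) 0 0 = right_value T Q (reduced psi) n l.
Proof.
rewrite /right_vec /hw_vec tensvr_sum scaler_sumr mulmx_sumr summxE.
rewrite /right_value mulr_sumr.
apply: eq_bigr => m _.
rewrite tensvrZ scalerA entryZ tensvrE -/(bvec3 _ _ _) -/(coord3 _ _ _ _).
rewrite /reduced -/t -/q -/Q.
have tm := expf_neq0 (m : nat) t0.
have -> : T ^+ m = t ^+ m * t ^+ m by rewrite /T expr2 exprMn.
move: (coord3 _ _ _ _) (right_scale _ _ _ _) (hw_coef _ _ _) => v s c.
by field; rewrite tm.
Qed.

Lemma reduced_coinvariance psi a b c : psi *m Sm3 N h = 0 ->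
  coinvariance T Q (reduced psi) a b c = 0.
Proof.
move=> h0; have [|] := boolP [|| N < a, N < b | N < c]%N.
  move=> big.
  have z a' b' c' : (a <= a')%N -> (b <= b')%N -> (c <= c')%N ->
      reduced psi a' b' c' = 0.
    move=> la lb lc; rewrite /reduced /coord3 bvec3_big ?mulmx0 ?mxE ?mul0r //.
    by case/or3P: big => lt; apply/or3P; [apply: Or31|apply: Or32|apply: Or33];
      apply: leq_trans lt _.
  by rewrite /coinvariance !z // !mulr0 !addr0.
rewrite !negb_or -!leqNgt => /and3P[la lb lc].
have := coord3_Sm3_coinvariance psi la lb lc.
rewrite h0 /coord3 mul0mx mxE => /esym/eqP.
have qq' : q - q^-1 != 0.
  by apply: contraNneq qq => e0; rewrite -(mulfV q0) expr2 -mulrBr e0 mulr0.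
rewrite mulf_eq0 => /orP[|/eqP //]; apply: contraTeq => _.
by rewrite mulf_neq0 ?invr_eq0 ?mulf_neq0 ?expf_neq0.
Qed.

Hypothesis N3 : (3 <= N)%N.

(** The functional with coordinates [seed_profile]: since n is at most 3, hence at
    most N, every index triple of sum n occurs among the basis vectors. *)
Definition seed n l : 'rV[C]_(N.+1 * N.+1 * N.+1) :=
  \row_k (let a := (N - (mxtens_unindex (mxtens_unindex k).1).1)%N in
          let b := (N - (mxtens_unindex (mxtens_unindex k).1).2)%N in
          let c := (N - (mxtens_unindex k).2)%N in
          t ^+ b * seed_profile T Q n l a b c).

Lemma reduced_seed n l a b c : (n <= 3)%N ->
  reduced (seed n l) a b c = seed_profile T Q n l a b c.
Proof.
move=> n3; rewrite /reduced; have [|] := boolP [|| N < a, N < b | N < c]%N.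
  move=> big; rewrite /coord3 bvec3_big // mulmx0 mxE mul0r /seed_profile.
  case: eqP => // abc; exfalso; have nN : (n <= N)%N by apply: leq_trans n3 N3.
  rewrite -abc in nN; move: big; apply/negP; rewrite !negb_or -!leqNgt.
  by rewrite !(leq_trans _ nN) // ?leq_addl // -addnA ?leq_addr // addnCA
    leq_addr.
rewrite !negb_or -!leqNgt => /and3P[la lb lc].
rewrite coord3_entry // mxE !mxtens_indexK; cbn [fst snd].
rewrite ?mxtens_indexK; cbn [fst snd].
by rewrite !inordK ?ltnS ?leq_subr // !subKn // mulrC mulKf // expf_neq0.
Qed.

Lemma seed_coinvariant n l : (n <= 3)%N -> seed n l *m Sm3 N h = 0.
Proof.
move=> n3; apply: coord3_eq0 => a b c la lb lc; rewrite coord3_Sm3_coinvariance //.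
suff -> : coinvariance T Q (reduced (seed n l)) a b c = 0 by rewrite mulr0.
rewrite /coinvariance !reduced_seed //.
apply: (seed_profile_coinvariance Q0 _ l a b c n3).
by rewrite /T qpow_half_expr; apply: generic_nondeg.
Qed.

End TripleFunctionals.

(** * The Yang-Baxter equation near the top weight *)

Section TopWeight.
Variables (R : realType) (N : nat) (h : Cplx R) (P : nat -> End2 R N).
Variable r : nat -> Cplx R -> Cplx R.
Let q := cexp h.
Hypotheses (N3 : (3 <= N)%N) (gen : generic q) (hP : spin_projectors h P).
Let T := (q ^+ N) ^+ 2.
Let Q := q ^+ 2.

Lemma YangBaxter_yb_sum l n i j : YangBaxter (Rop P r) l l ->
  (0 < n <= 3)%N -> (i <= n)%N -> (j <= n)%N ->
  yb_sum n (sixj T Q n) (sixj_weight T Q n) (fun k => r (N - k)%N l)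
    (fun k => r (N - k)%N l) (fun k => r (N - k)%N (l + l)) i j = 0.
Proof.
move=> yb n3 lein lejn.
have TE := qpow_half_expr N h.
have nd : nondeg T Q by apply: generic_nondeg.
have Q0 : Q != 0 by rewrite expf_neq0 //; case: gen.
have n3' : (n <= 3)%N by case/andP: n3.
have hq2 : q ^+ 2 = 1 -> q = 1.
  by move=> e; have := gen.2 2%N isT; rewrite e eqxx.
have leN k : (k <= n)%N -> (k <= N)%N.
  by move=> lk; apply: leq_trans (leq_trans lk n3') N3.
have le3 k : (k <= n)%N -> (k <= 3)%N by move=> lk; apply: leq_trans lk n3'.
have qn k : (0 < k)%N -> qnum h k%:R != 0 by apply: generic_qnum_neq0.
have eig l' k : (k <= n)%N ->
    Rop P r l' *m hw_vec N h k = r (N - k)%N l' *: hw_vec N h k.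
  move=> lk; apply: (Rop_hw_vec hP qn) => //; rewrite ?leN //.
    by rewrite DSp_hw_vec ?leN ?le3.
  by rewrite DSz_hw_vec.
have w12 l' k : (k <= n)%N ->
    op12 (Rop P r l') *m left_vec N h n k = r (N - k)%N l' *: left_vec N h n k.
  move=> lk; rewrite -scalemxAr op12_tensv eig //.
  by rewrite tensvZl scalerA mulrC -scalerA.
have g23 l' k : (k <= n)%N ->
    op23 (Rop P r l') *m right_vec N h n k = r (N - k)%N l' *: right_vec N h n k.
  move=> lk; rewrite -scalemxAr op23_tensvr eig //.
  by rewrite tensvrZ scalerA mulrC -scalerA.
have eqv l' := Rop_equivariant hP r l'.
have scaleE x (A : 'M[Cplx R]_1) : (x *: A) 0 0 = x * A 0 0 by rewrite mxE.
pose coinv (psi : 'rV_(N.+1 * N.+1 * N.+1)) := psi *m Sm3 N h = 0.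
have cv psi : coinv psi ->
    forall a b c, coinvariance T Q (reduced h psi) a b c = 0.
  move=> c0 a b c; rewrite /T -TE; exact: reduced_coinvariance.
apply: (@yb_sum_eq0 _ _ n (op12 (Rop P r l)) (op12 (Rop P r (l + l)))
  (op23 (Rop P r l)) (op23 (Rop P r (l + l))) coinv
  (left_vec N h n) (right_vec N h n) _ _ _ _ (sixj_den T Q n) (T ^+ n)) => //.
- move=> psi G; rewrite !inE /coinv => /or4P[] /eqP-> c0;
  by rewrite -mulmxA ?(op12_Sm3 (eqv _)) ?(op23_Sm3 (eqv _)) mulmxA c0 mul0mx.
- by move=> k; apply: w12.
- by move=> k; apply: w12.
- by move=> k; apply: g23.
- by move=> k; apply: g23.
- exact: sixj_den_neq0.
- by rewrite expf_neq0 // (nondeg_neq0 nd).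
- by move=> k lk; apply: sixj_weight_neq0.
- move=> psi k c0 lk; apply/matrixP => x y.
  rewrite !ord1 scaleE left_vecE summxE TE.
  under eq_bigr => m _ do rewrite scaleE right_vecE TE.
  exact: (left_of_right Q0 nd (cv _ c0)).
- move=> psi k c0 lk; apply/matrixP => x y.
  rewrite !ord1 2!scaleE right_vecE summxE TE.
  under eq_bigr => m _ do rewrite scaleE left_vecE TE.
  exact: (right_of_left Q0 nd (cv _ c0)).
move=> k lk; exists (seed N h n (n - k)%N).
have cs := seed_coinvariant gen N3 (n - k)%N n3'.
have [] := right_value_leading Q0 nd (cv _ cs) n3 lk.
- by move=> a b c lt; rewrite reduced_seed // seed_profile_gt.
- rewrite reduced_seed //; have := seed_profile_lead T Q (leq_subr k n).
  by rewrite subKn // TE.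
move=> lo hi; split=> //.
  move=> m lt; apply/matrixP => x y.
  by rewrite !ord1 right_vecE TE lo // mxE.
apply: contraNneq hi => /(congr1 (fun A : 'M[Cplx R]_1 => A 0 0)).
by rewrite right_vecE TE mxE => ->.
Qed.

Lemma eigenvalue_relation (l Z : Cplx R) : YangBaxter (Rop P r) l l ->
  r N l = 1 -> r N (l + l) = 1 ->
  Z != 0 -> Z != 1 -> Z != -1 -> T != Z ->
  T^+2 + Q*Z != 0 -> T^+2 + Q*Z^+2 != 0 ->
  r N.-1 l * (T - Z) = T * Z - 1 ->
  r N.-2 l * (T - Z) * (T - Q * Z) = (T * Z - 1) * (T * Z - Q).
Proof.
move=> yb rl rll Z0 Z1 Zm1 TZ h1 h2 rx.
pose d k := r (N - k)%N l; pose D k := r (N - k)%N (l + l).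
have -> : r N.-2 l = d 2%N by rewrite /d subn2.
apply: (@second_ratio_forced _ T Q Z d D) => //.
- exact: generic_nondeg.
- by rewrite /d subn0.
- by rewrite /D subn0.
- by rewrite /d subn1.
- by move=> n i j; apply: YangBaxter_yb_sum.
Qed.

(** The same relation with Z expressed through x = r_(2s-1)(l) and the common
    factors (T^2 - 1)(Q - 1) cancelled; unlike the original, it retains its
    content in the limit q -> 1, where [g] tends to 2N - 1. *)
Lemma eigenvalue_relation_reduced (l : Cplx R) (x := r N.-1 l)
    (g := \sum_(i < (2 * N).-1) Q ^+ i) : YangBaxter (Rop P r) l l ->
  r N l = 1 -> r N (l + l) = 1 ->
  T + x != 0 -> x * T + 1 != 0 -> x - 1 != 0 -> x + 1 != 0 ->
  T ^+ 2 * (T + x) + Q * (x * T + 1) != 0 ->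
  T ^+ 2 * (T + x) ^+ 2 + Q * (x * T + 1) ^+ 2 != 0 ->
  r N.-2 l * (Q * g - x * T) - x * (x * Q * g - T) = 0.
Proof.
move=> yb rl rll h1 h2 h3 h4 h5 h6.
have key := @eigenvalue_relation l ((x * T + 1) / (T + x)) yb rl rll.
have q0 : q != 0 by case: gen.
have T2 : T ^+ 2 - 1 != 0.
  by rewrite /T -!exprM -(expr0 q) generic_expr_neq //; clear -N3; lia.
have Q1 : Q - 1 != 0 by rewrite /Q -(expr0 q) generic_expr_neq.
have TQg : T ^+ 2 - Q = Q * ((Q - 1) * g).
  rewrite /g -subrX1 mulrBr mulr1 -exprS; congr (_ - _).
  by rewrite /T /Q -!exprM; congr (_ ^+ _); clear -N3; lia.
rewrite -/x in key; move: (r N.-2 l) key h1 h2 h3 h4 h5 h6 T2 Q1 TQg.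
move: x g T Q; clear => x g T Q z key h1 h2 h3 h4 h5 h6 T2 Q1 TQg.
have T1 : T + 1 != 0.
  apply: contraNneq T2 => e; have := subr_sqr T 1.
  by rewrite e mulr0 expr1n => ->.
have Tm1 : T - 1 != 0.
  apply: contraNneq T2 => e; have := subr_sqr T 1.
  by rewrite e mul0r expr1n => ->.
pose Z := (x * T + 1) / (T + x).
have Zmul : Z * (T + x) = x * T + 1 by rewrite divfK.
have nzZ u v : u * (T + x) = v -> v != 0 -> u != 0.
  by move=> <-; rewrite mulf_eq0 negb_or => /andP[].
have Z0 : Z != 0 by apply: (nzZ _ _ Zmul).
have Z1 : Z != 1.
  rewrite -subr_eq0; apply: (nzZ _ ((T - 1) * (x - 1))).
    by rewrite mulrBl Zmul; ring.
  by rewrite mulf_neq0.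
have Zm1 : Z != -1.
  rewrite -subr_eq0; apply: (nzZ _ ((T + 1) * (x + 1))).
    by rewrite mulrBl Zmul; ring.
  by rewrite mulf_neq0.
have eTZ : (T - Z) * (T + x) = T ^+ 2 - 1 by rewrite mulrBl Zmul; ring.
have TZ : T != Z by rewrite -subr_eq0; apply: (nzZ _ _ eTZ).
have TZ1 : T ^+ 2 + Q * Z != 0.
  by apply: nzZ h5; rewrite mulrDl -mulrA Zmul.
have TZ2 : T ^+ 2 + Q * Z ^+ 2 != 0.
  apply: (nzZ _ _ erefl); apply: (nzZ _ _ _ h6).
  by rewrite -Zmul; ring.
have rel : x * (T - Z) = T * Z - 1.
  by apply: (mulIf h1); rewrite -mulrA eTZ mulrBl -mulrA Zmul; ring.
have := key Z0 Z1 Zm1 TZ TZ1 TZ2 rel; rewrite -/Z => {}key.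
apply: (mulfI Q1); rewrite mulr0; apply: (mulfI T2); rewrite mulr0.
have e1 : (T - Q * Z) * (T + x) = (T ^+ 2 - Q) - x * T * (Q - 1).
  by rewrite mulrBl -(mulrA Q) Zmul; ring.
have e2 : (T * Z - 1) * (T + x) = x * (T ^+ 2 - 1) by rewrite -rel -mulrA eTZ.
have e3 : (T * Z - Q) * (T + x) = x * (T ^+ 2 - Q) - T * (Q - 1).
  by rewrite mulrBl -(mulrA T) Zmul; ring.
have : z * ((T - Z) * (T + x)) * ((T - Q * Z) * (T + x)) =
    ((T * Z - 1) * (T + x)) * ((T * Z - Q) * (T + x)).
  by rewrite mulrACA [RHS]mulrACA -key; ring.
rewrite eTZ e1 e2 e3 TQg => e.
transitivity (z * (T ^+ 2 - 1) * (Q * ((Q - 1) * g) - x * T * (Q - 1))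
   - x * (T ^+ 2 - 1) * (x * (Q * ((Q - 1) * g)) - T * (Q - 1))); first by ring.
by rewrite e subrr.
Qed.
End TopWeight.

(** * Limits of complex functions *)

Section Convergence.
Variable R : realType.
Notation C := (Cplx R).

Lemma cvg_expr T (F : set_system T) (f : T -> C) (a : C) n : Filter F ->
  f x @[x --> F] --> a -> f x ^+ n @[x --> F] --> a ^+ n.
Proof.
move=> FF fa; elim: n => [|n IH].
  have -> : (fun x => f x ^+ 0) = cst 1 by apply/funext => x; rewrite expr0.
  by rewrite expr0; apply: cvg_cst.
have -> : (fun x => f x ^+ n.+1) = (fun x => f x * f x ^+ n).
  by apply/funext => x; rewrite exprS.
by rewrite exprS; exact: (cvgM fa IH).
Qed.

Lemma uniform_cvg_at T (F : set_system T) (A : set C) (f : T -> C -> C)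
    (g : C -> C) l : Filter F ->
  {uniform A, f @ F --> g} -> A l -> f x l @[x --> F] --> g l.
Proof.
move=> FF fg Al; apply/cvgrPdist_lt => eps eps0.
have : nbhs (g : {uniform` A -> C}) [set k | `|g l - k l| < eps].
  apply/uniform_nbhs; exists [set xy | `|xy.1 - xy.2| < eps].
  split; last by move=> k; apply.
  by rewrite -entourage_ballE; exists eps => // xy; rewrite -ball_normE.
by move/fg.
Qed.

Lemma cvg_cexp0 : cexp z @[z --> (0 : C)] --> (1 : C).
Proof.
pose emb (x : R) : C := x%:C%C.
have cr (f : R -> R) : {for 0, continuous f} ->
  emb (f (complex.Re z)) @[z --> (0 : C)] --> emb (f 0) /\
  emb (f (complex.Im z)) @[z --> (0 : C)] --> emb (f 0).
  move=> /cvgrPdist_lt cf; split;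
    apply/(@cvgrPdist_lt C C C (nbhs (0 : C)) (nbhs_filter _)) => -[e e'];
    rewrite ltcE /= => /andP[/eqP -> e0].
  1,2: have /cf/nbhs_ballP[d /= d0 hd] := e0.
  1,2: apply/nbhs_ballP; exists (d%:C%C) => /=; rewrite ?ltcR // => z.
  1,2: rewrite /ball_ /= sub0r normrN => zd.
  1,2: rewrite /emb -rmorphB normc_def /= expr0n addr0 sqrtr_sqr ltcR.
  1,2: apply: hd; rewrite -ball_normE /= sub0r normrN -ltcR.
  1,2: apply: le_lt_trans zd.
    exact: normc_ge_Re.
  by rewrite normc_def lecR -sqrtr_sqr ler_wsqrtr // lerDr sqr_ge0.
have [e1 _] := cr expR (@continuous_expR R 0).
have [_ c1] := cr cos (@continuous_cos R 0).
have [_ s1] := cr sin (@continuous_sin R 0).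
rewrite expR0 in e1; rewrite cos0 in c1; rewrite sin0 in s1.
have -> : (@cexp R) = (fun z : C => emb (expR (complex.Re z))
    * (emb (cos (complex.Im z)) + ('i%C : C) * emb (sin (complex.Im z)))).
  by apply/funext => z; rewrite /cexp; simpc.
have -> : (1 : C) = emb 1 * (emb 1 + ('i%C : C) * emb 0).
  by rewrite mulr0 addr0 mulr1.
exact: (cvgM e1 (cvgD c1 (cvgM (cvg_cst ('i%C : C)) s1))).
Qed.

Lemma cexp_eq1_small (z : C) : `|z| < 1 -> cexp z = 1 -> z = 0.
Proof.
case: z => a b; rewrite normc_def /= => zl; rewrite /cexp /= => -[hr hi].
have bl : `|b| < 1.
  rewrite -ltcR; apply: le_lt_trans zl; rewrite lecR -sqrtr_sqr ler_wsqrtr //.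
  by rewrite lerDr sqr_ge0.
have sb : sin b = 0.
  by move/eqP: hi; rewrite mulf_eq0 gt_eqF ?expR_gt0 // => /eqP.
have pi1 : 1 < pi :> R by apply: lt_le_trans (pi_ge2 R); rewrite ltr1n.
have b0 : b = 0.
  apply/eqP; case: (ltgtP b 0) => // b0.
    have : 0 < sin (- b).
      apply: sin_gt0_pi; rewrite oppr_gt0 b0 /= (le_lt_trans (ler_norm _)) //.
      by rewrite normrN (lt_trans bl).
    by rewrite sinN sb oppr0 ltxx.
  have : 0 < sin b.
    apply: sin_gt0_pi; rewrite b0 /= (le_lt_trans (ler_norm _)) //.
    by rewrite (lt_trans bl).
  by rewrite sb ltxx.
by move: hr; rewrite b0 cos0 mulr1 -expR0 => /expR_inj ->.
Qed.

(** Limits as q tends to 1 through generic values are meaningful, since every real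
    number larger than 1 is generic. *)
Lemma generic_proper : ProperFilter (within (@generic R) (nbhs (1 : C))).
Proof.
apply: within_nbhs_proper => A /nbhs_ballP[e /= e0 hA].
have [e' e'0 ee'] : exists2 x : R, 0 < x & (x%:C%C <= e).
  move: e0; case: e {hA} => a b; rewrite ltcE /= => /andP[/eqP b0 a0].
  by exists a => //; rewrite lecE /= b0 eqxx lexx.
pose q : C := (1 + e' / 2)%:C%C.
have q1 : 1 < 1 + e' / 2 by rewrite ltrDl divr_gt0.
exists q; split.
  split; first by rewrite eq_complex /= eqxx andbT gt_eqF // (lt_trans _ q1).
  move=> n n0; rewrite -rmorphXn eq_complex /= eqxx andbT gt_eqF //.
  by rewrite exprn_egt1 // -lt0n.
apply: hA; rewrite -ball_normE /=; apply: lt_le_trans ee'.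
have -> : 1 - q = (- (e' / 2))%:C%C.
  apply/eqP; rewrite eq_complex /= oppr0 addr0 eqxx andbT.
  by rewrite opprD addrA subrr add0r.
rewrite normc_def /= expr0n addr0 sqrtr_sqr ltcR normrN gtr0_norm ?divr_gt0 //.
by rewrite ltr_pdivrMr // ltr_pMr // ltr1n.
Qed.
End Convergence.

(** * The second coefficient for generic q *)

Section Generic.
Variable R : realType.
Notation C := (Cplx R).

(** This is [eigenvalue_relation] with Z = q^(2l), which is close to 1 and, the
    exponential being injective near 0, different from 1 for small nonzero l. *)
Lemma second_coefficient N (h : C) (P : nat -> End2 R N) (rho : C)
    (r : nat -> C -> C) : (4 <= N)%N ->
  generic (cexp h) -> spin_projectors h P -> Rmatrix_on P rho r ->
  (forall j, (j <= N)%N -> r j 0 = 1) ->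
  (\forall l \near (0 : C),
     r N.-1 l = qnum h (N%:R + l) / qnum h (N%:R - l)) ->
  \forall l \near (0 : C),
    r N.-2 l = qnum h (N%:R + l) / qnum h (N%:R - l)
               * (qnum h (N%:R - 1 + l) / qnum h (N%:R - 1 - l)).
Proof.
move=> N4 gen hP [rho0 _ yb rN] r0 hr.
pose q := cexp h; pose T := (q ^+ N) ^+ 2; pose Q := q ^+ 2.
have q0 : q != 0 := gen.1.
have q1 : q != 1 := gen.2 1%N isT.
have h0 : h != 0.
  by apply: contraNneq q1 => h0; rewrite /q h0 cexp0.
have expn a b : a != b -> q ^+ a - q ^+ b != 0 by apply: generic_expr_neq.
pose Z (l : C) := qpow h (l + l).
have cw : (l + l) * h @[l --> (0 : C)] --> (0 : C).
  have -> : (0 : C) = (0 + 0) * h by rewrite addr0 mul0r.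
  rewrite [in X in X --> _]addr0 mul0r.
  exact: (cvgM (cvgD cvg_id cvg_id) (cvg_cst h)).
have cZ : Z l @[l --> (0 : C)] --> (1 : C).
  exact: (cvg_comp _ _ cw (@cvg_cexp0 R)).
have nz (f : C -> C) (a : C) : f l @[l --> (0 : C)] --> a -> a != 0 ->
    \forall l \near (0 : C), f l != 0.
  by move=> /cvgr_neq0; apply.
have c2 : Z l ^+ 2 @[l --> (0 : C)] --> (1 : C) ^+ 2.
  exact (@cvg_expr R _ _ Z 1 2 _ cZ).
rewrite expr1n in c2.
have nZm1 := nz _ _ (cvgD cZ (cvg_cst (1 : C))) _.
have nTZ := nz _ _ (cvgB (cvg_cst T) cZ) _.
have nTQZ := nz _ _ (cvgB (cvg_cst T) (cvgM (cvg_cst Q) cZ)) _.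
have nTZ1 := nz _ _ (cvgD (cvg_cst (T ^+ 2)) (cvgM (cvg_cst Q) cZ)) _.
have nTZ2 := nz _ _ (cvgD (cvg_cst (T ^+ 2)) (cvgM (cvg_cst Q) c2)) _.
rewrite mulr1 in nTQZ nTZ1 nTZ2.
have h2 : (1 : C) + 1 != 0 by rewrite -[1 + 1]/(2%:R) pnatr_eq0.
have hT1 : T - 1 != 0 by rewrite /T -exprM -(expr0 q) expn //; clear -N4; lia.
have hTQ : T - Q != 0 by rewrite /T -exprM expn //; clear -N4; lia.
have hTQ2 : T ^+ 2 + Q != 0.
  have : T ^+ 4 - Q ^+ 2 != 0 by rewrite /T -!exprM expn //; clear -N4; lia.
  have sq (u v : C) : u ^+ 4 - v ^+ 2 = (u ^+ 2 + v) * (u ^+ 2 - v) by ring.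
  by apply: contraNneq => e; rewrite sq e mul0r.
have small : \forall l \near (0 : C), `|(l + l) * h| < 1.
  by apply: (cvgr0_norm_lt _ cw).
have rho1 : \forall l \near (0 : C), `|l| < rho.
  by apply/nbhs_ballP; exists rho => // l; rewrite -ball_normE /= sub0r normrN.
have rho2 : \forall l \near (0 : C), `|l + l| < rho.
  have c0 : (l + l) @[l --> (0 : C)] --> (0 : C) + 0.
    exact: (cvgD cvg_id cvg_id).
  by rewrite addr0 in c0; apply: (cvgr0_norm_lt _ c0).
have qn x (u := qpow h x) : qnum h x = (u - u^-1) / (q - q^-1).
  by rewrite /qnum (negPf q1) qpowN.
have qq : q * q - 1 != 0 by rewrite -expr2 -(expr0 q) expn.
near=> l.
have lrho : `|l| < rho by near: l.
have llrho : `|l + l| < rho by near: l.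
have lsmall : `|(l + l) * h| < 1 by near: l.
have rl : r N.-1 l = qnum h (N%:R + l) / qnum h (N%:R - l) by near: l.
have Zm1 : Z l + 1 != 0 by near: l; exact: nZm1.
have TZ : T - Z l != 0 by near: l; exact: nTZ.
have TQZ : T - Q * Z l != 0 by near: l; exact: nTQZ.
have TZ1 : T ^+ 2 + Q * Z l != 0 by near: l; exact: nTZ1.
have TZ2 : T ^+ 2 + Q * Z l ^+ 2 != 0 by near: l; exact: nTZ2.
pose t := q ^+ N; pose z := qpow h l.
have t0 : t != 0 by rewrite expf_neq0.
have z0 : z != 0 := qpow_neq0 h l.
have Zz : Z l = z * z by rewrite /Z qpowD.
have pN : qpow h N%:R = t by rewrite qpowX.
have p1 : qpow h 1 = q by rewrite /qpow mul1r.
have e1 : qnum h (N%:R + l) / qnum h (N%:R - l) = (T * Z l - 1) / (T - Z l).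
  rewrite !qn !qpowD qpowN pN -/z Zz /T -/t.
  move: TZ; rewrite Zz /T -/t => TZ; field.
  by apply/and5P; split.
have e2 : qnum h (N%:R - 1 + l) / qnum h (N%:R - 1 - l) =
    (T * Z l - Q) / (T - Q * Z l).
  rewrite !qn !qpowD !qpowN pN p1 -/z Zz /T -/t /Q.
  move: TQZ; rewrite Zz /T -/t /Q => TQZ; field.
  by apply/and5P; split.
rewrite e1 e2; have [->|l0] := eqVneq l 0.
  (* at l = 0 one has Z = 1, which the eigenvalue relation excludes *)
  rewrite r0; last by rewrite -subn2 leq_subr.
  by rewrite /Z addr0 qpow0 !mulr1 !divff // mulr1.
have Z1 : Z l != 1.
  apply: contraNneq l0 => /(cexp_eq1_small lsmall)/eqP.
  by rewrite mulf_eq0 (negPf h0) orbF -mulr2n mulrn_eq0.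
have := eigenvalue_relation (ltnW N4) gen hP (yb l l lrho lrho llrho)
  (rN l lrho) (rN _ llrho) (qpow_neq0 _ _ : Z l != 0) Z1.
rewrite -/q -/T -/Q rl e1 divfK //.
rewrite -subr_eq0 opprK -(subr_eq0 T) => /(_ Zm1 TZ TZ1 TZ2 erefl) e.
have -> : r N.-2 l =
    r N.-2 l * (T - Z l) * (T - Q * Z l) / ((T - Z l) * (T - Q * Z l)).
  by rewrite -(mulrA _ (T - Z l)) mulfK // mulf_neq0.
by rewrite e mulf_div.
Unshelve. all: by end_near.
Qed.
End Generic.

(** * The limit q -> 1 *)

Section Limit.
Variables (R : realType) (N : nat).
Hypothesis N4 : (4 <= N)%N.
Notation C := (Cplx R).
Notation bvec2 := (bvec2 R N).
Notation hw_vec0 := (hw_vec N (0 : C)).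

Lemma flip_bvec2 a b : flip R N *m bvec2 a b = bvec2 b a.
Proof.
apply/colP => i; rewrite mxE /bvec2.
rewrite (bigD1 (mxtens_index ((mxtens_unindex i).2, (mxtens_unindex i).1))) //.
rewrite big1 => [|j].
  by rewrite !mxE !mxtens_indexK /= !eqxx mul1r addr0 mulrC.
case: (mxtens_indexP j) => c d; rewrite !mxE !mxtens_indexK.
cbn [fst snd] => ne.
case: eqP => [e1|_]; last by rewrite mul0r.
case: eqP => [e2|_]; last by rewrite mul0r.
by case/negP: ne; rewrite e1 e2.
Qed.

Let kap1 x : qpow (0 : C) x = 1. Proof. by rewrite /qpow mulr0 cexp0. Qed.

Lemma hw_vec1_at1 : hw_vec0 1 = bvec2 0 1 - bvec2 1 0.
Proof.
rewrite /hw_vec !(big_ord_recl, big_ord0) /= /bump /= !(addn0, subn0, subnn).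
rewrite kap1 cexp0 /hw_coef /table /=.
by rewrite !expr1n !mul1r scale1r scaleN1r addr0.
Qed.

Lemma hw_vec2_at1 : hw_vec0 2 = bvec2 0 2 - 2 *: bvec2 1 1 + bvec2 2 0.
Proof.
rewrite /hw_vec !(big_ord_recl, big_ord0) /= /bump /= !(addn0, subn0, subnn).
rewrite kap1 cexp0 /hw_coef /table /=.
by rewrite !expr1n !mul1r !scale1r addr0 scaleNr addrA.
Qed.

Lemma bvec2_entry a b k : (k <= N)%N ->
  bvec2 a b (mxtens_index (inord N, inord (N - k))) 0 =
  ((a == 0)%N && (b == k))%:R.
Proof.
move=> le; rewrite /bvec2 mxE mxtens_indexK !mxE; cbn [fst snd].
rewrite !inordK ?ltnS ?leq_subr // -[X in (_ == X)%N]addn0 eqn_add2l.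
have -> : (N - k + b == N)%N = (b == k) by rewrite -{2}(subnK le) eqn_add2l.
by rewrite -natrM mulnb.
Qed.

Lemma hw_vec_at1_neq0 : hw_vec0 1 != 0 /\ hw_vec0 2 != 0.
Proof.
have le1 : (1 <= N)%N by apply: leq_trans N4.
have le2 : (2 <= N)%N by apply: leq_trans N4.
have subE n (u v : 'cV[C]_n) i : (u - v) i 0 = u i 0 - v i 0 by rewrite !mxE.
have addE n (u v : 'cV[C]_n) i : (u + v) i 0 = u i 0 + v i 0 by rewrite mxE.
have scaleE n x (u : 'cV[C]_n) i : (x *: u) i 0 = x * u i 0 by rewrite mxE.
have zE n (i : 'I_n) : (0 : 'cV[C]_n) i 0 = 0 by rewrite mxE.
split; apply/eqP => /colP.
  move=> /(_ (mxtens_index (inord N, inord (N - 1)))).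
  rewrite hw_vec1_at1 subE !bvec2_entry //= zE.
  by rewrite subr0 => /eqP; rewrite oner_eq0.
move=> /(_ (mxtens_index (inord N, inord (N - 2)))).
rewrite hw_vec2_at1 addE subE scaleE !bvec2_entry //= zE.
by rewrite mulr0 subr0 addr0 => /eqP; rewrite oner_eq0.
Qed.

Lemma flip_hw_vec :
  flip R N *m hw_vec0 1 = - hw_vec0 1 /\ flip R N *m hw_vec0 2 = hw_vec0 2.
Proof.
have swap (V : zmodType) (u v w : V) : u - v + w = w - v + u.
  by rewrite addrC addrA addrAC.
rewrite hw_vec1_at1 hw_vec2_at1 2!mulmxDr mulmxDr 2!mulmxN -scalemxAr.
rewrite (flip_bvec2 0 1) (flip_bvec2 1 0) (flip_bvec2 0 2) (flip_bvec2 1 1).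
by rewrite (flip_bvec2 2 0); split; [exact/esym/opprB | exact: swap].
Qed.

Lemma R_flip_hw_vec (l : C) : l != 1 ->
  R_flip N l *m hw_vec0 1 = ((1 + l) / (1 - l)) *: hw_vec0 1 /\
  R_flip N l *m hw_vec0 2 = hw_vec0 2.
Proof.
move=> l1; have l1' : 1 - l != 0 by rewrite subr_eq0 eq_sym.
rewrite /R_flip -!scalemxAl !mulmxBl -!scalemxAl; have [-> ->] := flip_hw_vec.
rewrite !mul1mx scalerN opprK; split.
  by rewrite -{1}[hw_vec0 1]scale1r -scalerDl scalerA mulrC.
by rewrite -{1}[hw_vec0 2]scale1r -scalerBl scalerA mulVf // scale1r.
Qed.

Variable P1 : nat -> End2 R N.
Hypothesis hP1 : spin_projectors 0 P1.

Let q0n n : (0 < n)%N -> qnum (0 : C) n%:R != 0.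
Proof. by rewrite qnum_log0 pnatr_eq0 -lt0n. Qed.

Let DSp_hw_vec0 k : (k <= 2)%N -> DSp 0 N *m hw_vec0 k = 0.
Proof.
move=> k2; apply: DSp_hw_vec; first by rewrite cexp0.
  exact: leq_trans k2 _.
by apply: leq_trans k2 _; apply: leq_trans N4.
Qed.

(** The extra term of the second R-matrix is invisible on these vectors, whose
    weights N - 1 and N - 2 are positive. *)
Lemma R_flip0_hw_vec (l : C) : l != 1 ->
  R_flip0 P1 l *m hw_vec0 1 = ((1 + l) / (1 - l)) *: hw_vec0 1 /\
  R_flip0 P1 l *m hw_vec0 2 = hw_vec0 2.
Proof.
move=> l1; have [e1 e2] := R_flip_hw_vec l1.
have kill k : (0 < k <= 2)%N -> P1 0%N *m hw_vec0 k = 0.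
  move=> /andP[k0 k2]; have kN : (k < N)%N.
    by apply: leq_trans N4; apply: (@leq_trans 3).
  rewrite (projector_hw_vec hP1 q0n (ltnW kN) (leq0n _) (DSp_hw_vec0 k2)
    (DSz_hw_vec _ _ _)).
  by rewrite ltn_eqF ?subn_gt0 // scale0r.
have -> : R_flip0 P1 l = R_flip N l
    + ((1 - l)^-1 * (beta R N * l / (l - alpha R N))) *: P1 0%N.
  by rewrite /R_flip0 scalerDr scalerA.
by rewrite 2!mulmxDl e1 e2 -2!scalemxAl !kill // !scaler0 !addr0.
Qed.

(** The eigenvalues of the limit on v_1 and v_2 contradict the limit of
    [eigenvalue_relation_reduced] at any fixed small nonzero l. *)
Lemma no_limit_of_regular (A : C -> End2 R N) :
  (forall l : C, l != 1 ->
     A l *m hw_vec0 1 = ((1 + l) / (1 - l)) *: hw_vec0 1 /\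
     A l *m hw_vec0 2 = hw_vec0 2) ->
  ~ limit_of_regular_Rmatrices P1 A.
Proof.
move=> hA [lq [P [r [r1 [rho [rho0 Ar1 fam cvg]]]]]].
(* any nonzero point with |2l| < rho and l <> 1 would do *)
pose l : C := rho / (3 * (1 + rho)).
have rho1 : 0 < 1 + rho by rewrite addr_gt0.
have l0 : 0 < l by rewrite divr_gt0 // mulr_gt0.
have lrho : l + l < rho.
  rewrite /l -mulrDl ltr_pdivrMr ?mulr_gt0 // -subr_gt0.
  have -> : rho * (3 * (1 + rho)) - (rho + rho) = rho + 3 * rho * rho by ring.
  by rewrite addr_gt0 // !mulr_gt0.
have l1 : l < 1.
  rewrite /l ltr_pdivrMr ?mulr_gt0 // mul1r -subr_gt0.
  have -> : 3 * (1 + rho) - rho = 3 + 2 * rho by ring.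
  by rewrite addr_gt0 // mulr_gt0.
have nl : `|l| = l by rewrite gtr0_norm.
have nll : `|l + l| = l + l by rewrite gtr0_norm // addr_gt0.
have lr : `|l| < rho by rewrite nl; apply: lt_trans lrho; rewrite ltrDl.
have llr : `|l + l| < rho by rewrite nll.
have l1' : l != 1 by rewrite lt_eqF.
pose x1 := (1 + l) / (1 - l).
have [A1 A2] := hA l l1'; have [v1 v2] := hw_vec_at1_neq0.
have eig k : (0 < k <= 2)%N ->
    Rop P1 r1 l *m hw_vec0 k = r1 (N - k)%N l *: hw_vec0 k.
  move=> /andP[k0 k2]; have kN : (k <= N)%N.
    by apply: leq_trans k2 _; apply: leq_trans N4.
  by rewrite (Rop_hw_vec hP1 q0n r1 l kN (DSp_hw_vec0 k2) (DSz_hw_vec _ _ _)).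
have eigenvalue_eq (u v : C) (w : 'cV[C]_(N.+1 * N.+1)) :
    w != 0 -> u *: w = v *: w -> u = v.
  move=> w0 /eqP; rewrite -subr_eq0 -scalerBl scaler_eq0 (negPf w0) orbF.
  by rewrite subr_eq0 => /eqP.
have r1E : r1 N.-1 l = x1.
  by apply: (eigenvalue_eq _ _ _ v1); rewrite -A1 Ar1 // eig // subn1.
have r2E : r1 N.-2 l = 1.
  by apply: (eigenvalue_eq _ _ _ v2); rewrite scale1r -[RHS]A2 Ar1 // eig // subn2.
pose F := within (@generic R) (nbhs (1 : C)).
have FF : ProperFilter F := generic_proper R.
pose x q := r q N.-1 l; pose z q := r q N.-2 l.
have cx : x q @[q --> F] --> x1.
  by rewrite -r1E; apply: (uniform_cvg_at _ (cvg _ (leq_pred N))).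
have cz : z q @[q --> F] --> (1 : C).
  rewrite -r2E; apply: (uniform_cvg_at _ (cvg _ _)) => //.
  by rewrite -subn2 leq_subr.
have cq : (q : C) @[q --> F] --> (1 : C) by apply: cvg_within.
have ce (f : C -> C) (a : C) n :
    f q @[q --> F] --> a -> f q ^+ n @[q --> F] --> a ^+ n.
  by move=> fa; exact: (@cvg_expr R C F f a n _ fa).
have ce1 (f : C -> C) n :
    f q @[q --> F] --> (1 : C) -> f q ^+ n @[q --> F] --> (1 : C).
  by move=> /(ce f 1 n); rewrite expr1n.
pose Q (q : C) := q ^+ 2; pose T (q : C) := (q ^+ N) ^+ 2.
have cQ : Q q @[q --> F] --> (1 : C) := ce1 id 2%N cq.
have cT : T q @[q --> F] --> (1 : C) := ce1 _ 2%N (ce1 id N cq).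
pose g (q : C) := \sum_(i < (2 * N).-1) Q q ^+ i.
have cg : g q @[q --> F] --> ((2 * N).-1%:R : C).
  rewrite /g; elim: (2 * N).-1 => [|n IH].
    by under eq_fun do rewrite big_ord0; exact: cvg_cst.
  have -> : (fun q => \sum_(i < n.+1) Q q ^+ i) =
      (fun q => \sum_(i < n) Q q ^+ i + Q q ^+ n).
    by apply/funext => q; rewrite big_ord_recr.
  by rewrite -natr1; exact: (cvgD IH (ce1 Q n cQ)).
have l1n : 1 - l != 0 by rewrite subr_eq0 eq_sym.
have two0 : (2 : C) != 0 by rewrite pnatr_eq0.
have x1p : x1 + 1 != 0.
  have -> : x1 + 1 = 2 / (1 - l) by rewrite /x1; field.
  by rewrite mulf_neq0 ?invr_eq0.
have x1m : x1 - 1 != 0.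
  have -> : x1 - 1 = 2 * l / (1 - l) by rewrite /x1; field.
  by rewrite mulf_neq0 ?invr_eq0 // mulf_neq0 // gt_eqF.
have nz (f : C -> C) (a : C) : f q @[q --> F] --> a -> a != 0 ->
    \forall q \near F, f q != 0.
  by move=> /cvgr_neq0; apply.
have c1 : (1 : C) @[q --> F] --> (1 : C) by exact: cvg_cst.
have cTx : T q + x q @[q --> F] --> 1 + x1 by exact: (cvgD cT cx).
have cxT : x q * T q + 1 @[q --> F] --> x1 * 1 + 1.
  exact: (cvgD (cvgM cx cT) c1).
have near1 := nz _ _ cTx.
have near2 := nz _ _ cxT.
have near3 := nz _ _ (cvgB cx c1) x1m.
have near4 := nz _ _ (cvgD cx c1) x1p.
have near5 := nz _ _ (cvgD (cvgM (ce _ _ 2%N cT) cTx) (cvgM cQ cxT)).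
have near6 := nz _ _ (cvgD (cvgM (ce _ _ 2%N cT) (ce _ _ 2%N cTx))
  (cvgM cQ (ce _ _ 2%N cxT))).
have near7 := nz _ _ (cvgB (cvgM cz (cvgB (cvgM cQ cg) (cvgM cx cT)))
  (cvgM cx (cvgB (cvgM (cvgM cx cQ) cg) cT))).
have genF : \forall q \near F, generic q by exact: withinT.
have n1 : 1 + x1 != 0 by rewrite addrC.
have n2 : x1 * 1 + 1 != 0 by rewrite mulr1.
have n5 : 1 ^+ 2 * (1 + x1) + 1 * (x1 * 1 + 1) != 0.
  have -> : 1 ^+ 2 * (1 + x1) + 1 * (x1 * 1 + 1) = 2 * (x1 + 1) by ring.
  by rewrite mulf_neq0.
have n6 : 1 ^+ 2 * (1 + x1) ^+ 2 + 1 * (x1 * 1 + 1) ^+ 2 != 0.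
  have -> : 1 ^+ 2 * (1 + x1) ^+ 2 + 1 * (x1 * 1 + 1) ^+ 2 =
    2 * (x1 + 1) ^+ 2 by ring.
  by rewrite mulf_neq0 // expf_neq0.
(* the contradiction: the limit of the left side of the reduced relation *)
have n7 : 1 * (1 * (2 * N).-1%:R - x1 * 1)
    - x1 * (x1 * 1 * (2 * N).-1%:R - 1) != 0.
  have -> : 1 * (1 * (2 * N).-1%:R - x1 * 1)
      - x1 * (x1 * 1 * (2 * N).-1%:R - 1) =
    - ((2 * N).-1%:R * ((x1 - 1) * (x1 + 1))) by ring.
  rewrite oppr_eq0 !mulf_neq0 // pnatr_eq0 -lt0n.
  by clear -N4; lia.
have famF : \forall q \near F, [/\ cexp (lq q) = q, spin_projectors (lq q) (P q),
   Rmatrix_on (P q) rho (r q) & regular (Rop (P q) (r q))] by exact: fam.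
near F => q.
have gq : generic q by near: q.
have [lqE hP [_ _ yb rN] _] : [/\ cexp (lq q) = q, spin_projectors (lq q) (P q),
   Rmatrix_on (P q) rho (r q) & regular (Rop (P q) (r q))].
  by near: q; exact: famF.
have h1 : T q + x q != 0 by near: q; exact: near1.
have h2 : x q * T q + 1 != 0 by near: q; exact: near2.
have h3 : x q - 1 != 0 by near: q; exact: near3.
have h4 : x q + 1 != 0 by near: q; exact: near4.
have h5 : T q ^+ 2 * (T q + x q) + Q q * (x q * T q + 1) != 0.
  by near: q; exact: near5.
have h6 : T q ^+ 2 * (T q + x q) ^+ 2 + Q q * (x q * T q + 1) ^+ 2 != 0.
  by near: q; exact: near6.
have h7 : z q * (Q q * g q - x q * T q) - x q * (x q * Q q * g q - T q) != 0.
  by near: q; exact: near7.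
case/eqP: h7.
have gq' : generic (cexp (lq q)) by rewrite lqE.
have key := eigenvalue_relation_reduced (ltnW N4) gq' hP (yb l l lr lr llr)
  (rN l lr) (rN _ llr).
by rewrite lqE in key; apply: key.
Unshelve. all: by end_near.
Qed.
End Limit.

(* N = 2s, h = log q *)
Theorem proposition7 (R : realType) (N : nat) (s_ge2 : (4 <= N)%N) :
  (forall (h : Cplx R) (P : nat -> End2 R N) (rho : Cplx R)
          (r : nat -> Cplx R -> Cplx R),
     generic (cexp h) ->
     spin_projectors h P ->
     Rmatrix_on P rho r ->
     (forall j : nat, (j <= N)%N ->
        r j 0 = 1 /\ (\forall l \near (0 : Cplx R), r j l * r j (- l) = 1)) ->
     (\forall l \near (0 : Cplx R),
        r N.-1 l = qnum h (N%:R + l) / qnum h (N%:R - l)) ->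
     \forall l \near (0 : Cplx R),
       r N.-2 l = qnum h (N%:R + l) / qnum h (N%:R - l)
                  * (qnum h (N%:R - 1 + l) / qnum h (N%:R - 1 - l)))
  /\
  (forall P1 : nat -> End2 R N, spin_projectors 0 P1 ->
     ~ limit_of_regular_Rmatrices P1 (@R_flip R N) /\
     ~ limit_of_regular_Rmatrices P1 (R_flip0 P1)).
Proof.
split=> [h P rho r gen hP hR r0 hr|P1 hP1].
  by apply: (second_coefficient s_ge2 gen hP hR _ hr) => j /r0[].
split; apply: (no_limit_of_regular s_ge2 hP1) => l l1.
  exact: R_flip_hw_vec.
exact: R_flip0_hw_vec.
Qed.
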